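(* If $\alpha$ is a generalized ribbon of size $m+n$, then there are isomorphisms of $\mathcal H_{m,n}(0)$-modules $$\mathbf P_\alpha\downarrow_{\mathcal H_{m,n}(0)}^{\mathcal H_{m+n}(0)}\ \cong\ \bigoplus_{\substack{\alpha=\beta\sqcup\gamma\\|\beta|=m\\|\gamma|=n}}\mathbf P_\beta\otimes\mathbf P_\gamma\ \cong\ \bigoplus_{\substack{\alpha=\beta\sqcup\gamma\\|\beta|=m,\ \beta'\in[\beta]\\|\gamma|=n,\ \gamma'\in[\gamma]}}\mathbf P_{\beta'}\otimes\mathbf P_{\gamma'} .$$
   Context: $\mathbb F$ is an arbitrary field. $\mathcal H_n(0)$ is the $\mathbb F$-algebra generated by $\pi_1,\ldots,\pi_{n-1}$ with relations $\pi_i^2=\pi_i$ and the braid relations of $\mathfrak S_n$; $\overline\pi_i:=\pi_i-1$; $\mathcal H_0(0)=\mathbb F$. $\mathcal H_{m,n}(0)\cong\mathcal H_m(0)\otimes\mathcal H_n(0)$ is the subalgebra of $\mathcal H_{m+n}(0)$ generated by the $\pi_i$ with $1\le i\le m+n-1$, $i\ne m$. $M\downarrow_B^A$ denotes restriction of an $A$-module to the subalgebra $B$. A composition $\alpha=(\alpha_1,\ldots,\alpha_\ell)$ is a sequence of positive integers, identified with its ribbon diagram: rows of lengths $\alpha_1,\ldots,\alpha_\ell$ from bottom to top, the last box of each row directly below the first box of the next row up. $\alpha\cdot\beta$ is concatenation and $\alpha\rhd\beta=(\alpha_1,\ldots,\alpha_{\ell-1},\alpha_\ell+\beta_1,\beta_2,\ldots)$.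 A generalized ribbon $\alpha=\alpha^1\oplus\cdots\oplus\alpha^k$ is a skew diagram whose connected components are ribbons $\alpha^1,\ldots,\alpha^k$, with $\alpha^{i+1}$ strictly northeast of $\alpha^i$; its size $|\alpha|$ is the number of boxes. $[\alpha^1]=\{\alpha^1\}$, $[\alpha]=\{\beta\cdot\alpha^k,\ \beta\rhd\alpha^k:\beta\in[\alpha^1\oplus\cdots\oplus\alpha^{k-1}]\}$, $[\emptyset]=\{\emptyset\}$. For a generalized ribbon $\alpha$ of size $N$, $\mathbf P_\alpha$ is the $\mathcal H_N(0)$-module with $\mathbb F$-basis the standard tableaux of shape $\alpha$ (fillings of the boxes with $1,\ldots,N$, each once, rows increasing left to right, columns increasing top to bottom), with $\overline\pi_i(\tau)=-\tau$ if $i$ is in a higher row of $\tau$ than $i+1$; $\overline\pi_i(\tau)=0$ if $i,i+1$ are in the same row; $\overline\pi_i(\tau)=s_i(\tau)$ (swap the entries $i$ and $i+1$) if $i$ is in a lower row than $i+1$. $\mathbf P_\emptyset=\mathbb F$. Decompositions $\alpha=\beta\sqcup\gamma$: fill each box of $\alpha$ with one of two symbols $\beta<\gamma$ so that each row is weakly increasing from left to right and each column is weakly increasing from top to bottom. The boxes filled with $\beta$ form a generalized ribbon denoted $\beta$, those filled with $\gamma$ a generalized ribbon denoted $\gamma$ (either may be empty). The direct sums have one summand (resp. one summand for each $\beta',\gamma'$) for each such filling. *)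

(* Defs.v *)
From HB Require Import structures.
From mathcomp Require Import all_boot all_order all_algebra perm.
From mathcomp Require Import boolp zify.

Set Implicit Arguments.
Unset Strict Implicit.
Unset Printing Implicit Defensive.

Import GRing.Theory.
Local Open Scope ring_scope.
Local Open Scope quotient_scope.

(* The unital associative F-algebra presented by generators and relations is
   realised as the formal algebraic expressions in the generators, modulo the
   least congruence containing the F-algebra axioms and the relations.
   Generators are numbered from 0: [HGen i] stands for pi_(i+1). *)
Inductive hterm (F : Type) (n : nat) : Type :=
| HScal of F
| HGen of 'I_n.-1
| HAdd of hterm F n & hterm F n
| HMul of hterm F n & hterm F n.
Arguments HScal {F n}.
Arguments HGen {F n}.

Inductive hcong (F : pzRingType) (n : nat) : hterm F n -> hterm F n -> Prop :=
| hc_refl x : hcong x x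
| hc_sym x y : hcong x y -> hcong y x
| hc_trans x y z : hcong x y -> hcong y z -> hcong x z
| hc_add x x' y y' : hcong x x' -> hcong y y' -> hcong (HAdd x y) (HAdd x' y')
| hc_mul x x' y y' : hcong x x' -> hcong y y' -> hcong (HMul x y) (HMul x' y')
| hc_addA x y z : hcong (HAdd x (HAdd y z)) (HAdd (HAdd x y) z)
| hc_addC x y : hcong (HAdd x y) (HAdd y x)
| hc_add0 x : hcong (HAdd (HScal 0) x) x
| hc_addN x : hcong (HAdd (HMul (HScal (-1)) x) x) (HScal 0)
| hc_mulA x y z : hcong (HMul x (HMul y z)) (HMul (HMul x y) z)
| hc_mul1l x : hcong (HMul (HScal 1) x) x
| hc_mul1r x : hcong (HMul x (HScal 1)) x
| hc_mulDl x y z : hcong (HMul (HAdd x y) z) (HAdd (HMul x z) (HMul y z))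
| hc_mulDr x y z : hcong (HMul x (HAdd y z)) (HAdd (HMul x y) (HMul x z))
| hc_scalD a b : hcong (HScal (a + b)) (HAdd (HScal a) (HScal b))
| hc_scalM a b : hcong (HScal (a * b)) (HMul (HScal a) (HScal b))
| hc_scalC a x : hcong (HMul (HScal a) x) (HMul x (HScal a))
| hc_idem i : hcong (HMul (HGen i) (HGen i)) (HGen i)
| hc_braid (i j : 'I_n.-1) : j = i.+1 :> nat ->
    hcong (HMul (HGen i) (HMul (HGen j) (HGen i)))
          (HMul (HGen j) (HMul (HGen i) (HGen j)))
| hc_comm (i j : 'I_n.-1) : (i.+1 < j)%N ->
    hcong (HMul (HGen i) (HGen j)) (HMul (HGen j) (HGen i)).

HB.instance Definition _ F n := gen_eqMixin (hterm F n).
HB.instance Definition _ F n := gen_choiceMixin (hterm F n).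

(* The defining relations of H_n(0), for operators on an F-vector space. *)
Definition hecke_rel (F : pzRingType) (V : lmodType F) (n : nat)
    (op : 'I_n.-1 -> {linear V -> V}) : Prop :=
  [/\ forall i v, op i (op i v) = op i v,
      forall (i j : 'I_n.-1) v, j = i.+1 :> nat ->
        op i (op j (op i v)) = op j (op i (op j v))
    & forall (i j : 'I_n.-1) v, (i.+1 < j)%N -> op i (op j v) = op j (op i v)].

Section Eval.
Variables (F : comPzRingType) (n : nat) (V : lmodType F).
Variable op : 'I_n.-1 -> {linear V -> V}.

Fixpoint heval (t : hterm F n) (v : V) : V :=
  match t with
  | HScal c => c *: v
  | HGen i => op i v
  | HAdd x y => heval x v + heval y v
  | HMul x y => heval x (heval y v)
  end.

Lemma hevalD t u v : heval t (u + v) = heval t u + heval t v.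
Proof.
elim: t u v => [c|i|x IHx y IHy|x IHx y IHy] u v /=.
- by rewrite scalerDr.
- by rewrite linearD.
- by rewrite IHx IHy addrACA.
- by rewrite IHy IHx.
Qed.

Lemma hevalZ t a v : heval t (a *: v) = a *: heval t v.
Proof.
elim: t v => [c|i|x IHx y IHy|x IHx y IHy] v /=.
- by rewrite !scalerA mulrC.
- by rewrite linearZ.
- by rewrite IHx IHy scalerDr.
- by rewrite IHy IHx.
Qed.

Lemma heval_cong : hecke_rel op ->
  forall s t, hcong s t -> heval s =1 heval t.
Proof.
case=> ri rb rc s t; elim=> {s t} /=.
- by [].
- by move=> x y _ e v; rewrite e.
- by move=> x y z _ e1 _ e2 v; rewrite e1 e2.
- by move=> x x' y y' _ e1 _ e2 v; rewrite e1 e2.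
- by move=> x x' y y' _ e1 _ e2 v; rewrite e2 e1.
- by move=> x y z v; rewrite addrA.
- by move=> x y v; rewrite addrC.
- by move=> x v; rewrite scale0r add0r.
- by move=> x v; rewrite scaleN1r addNr scale0r.
- by [].
- by move=> x v; rewrite scale1r.
- by move=> x v; rewrite scale1r.
- by [].
- by move=> x y z v; rewrite hevalD.
- by move=> a b v; rewrite scalerDl.
- by move=> a b v; rewrite scalerA.
- by move=> a x v; rewrite hevalZ.
- by move=> i v; apply: ri.
- by move=> i j e v; apply: rb.
- by move=> i j e v; apply: rc.
Qed.

End Eval.

Section Hecke.
Variables (F : fieldType) (n : nat).

Definition hcongb (x y : hterm F n) : bool := `[< hcong x y >].

Lemma hcongb_refl : reflexive hcongb.
Proof. by move=> x; apply/asboolP/hc_refl. Qed.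

Lemma hcongb_sym : symmetric hcongb.
Proof. by move=> x y; apply/asboolP/asboolP; apply: hc_sym. Qed.

Lemma hcongb_trans : transitive hcongb.
Proof.
by move=> y x z /asboolP xy /asboolP yz; apply/asboolP; apply: hc_trans xy yz.
Qed.

Canonical hcong_equiv := EquivRel hcongb hcongb_refl hcongb_sym hcongb_trans.

Definition hecke : Type := {eq_quot hcong_equiv}.
HB.instance Definition _ := Choice.on hecke.

Definition hcl (t : hterm F n) : hecke := \pi_({eq_quot hcong_equiv}) t.
Definition hrep (x : hecke) : hterm F n :=
  repr (x : {eq_quot hcong_equiv}).

Lemma hrepK x : hcl (hrep x) = x.
Proof. exact: reprK. Qed.

Lemma hcl_eq s t : hcong s t -> hcl s = hcl t.
Proof. by move=> st; apply/eqmodP/asboolP. Qed.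

Lemma hrep_cong t : hcong (hrep (hcl t)) t.
Proof. by apply/asboolP/(@eqmodP _ hcong_equiv); rewrite reprK. Qed.

Definition hadd (x y : hecke) : hecke := hcl (HAdd (hrep x) (hrep y)).
Definition hmul (x y : hecke) : hecke := hcl (HMul (hrep x) (hrep y)).
Definition hscal (a : F) : hecke := hcl (HScal a).

Lemma haddE s t : hadd (hcl s) (hcl t) = hcl (HAdd s t).
Proof. by apply/hcl_eq/hc_add; apply: hrep_cong. Qed.

Lemma hmulE s t : hmul (hcl s) (hcl t) = hcl (HMul s t).
Proof. by apply/hcl_eq/hc_mul; apply: hrep_cong. Qed.

Lemma hcl_ind (P : hecke -> Prop) : (forall t, P (hcl t)) -> forall x, P x.
Proof. by move=> Pc x; rewrite -(hrepK x). Qed.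

Lemma haddA : associative hadd.
Proof.
elim/hcl_ind=> x; elim/hcl_ind=> y; elim/hcl_ind=> z.
by rewrite !haddE; apply/hcl_eq/hc_addA.
Qed.

Lemma haddC : commutative hadd.
Proof.
by elim/hcl_ind=> x; elim/hcl_ind=> y; rewrite !haddE; apply/hcl_eq/hc_addC.
Qed.

Lemma hadd0 : left_id (hscal 0) hadd.
Proof. by elim/hcl_ind=> x; rewrite haddE; apply/hcl_eq/hc_add0. Qed.

Lemma haddN : left_inverse (hscal 0) (hmul (hscal (-1))) hadd.
Proof. by elim/hcl_ind=> x; rewrite hmulE haddE; apply/hcl_eq/hc_addN. Qed.

Lemma hmulA : associative hmul.
Proof.
elim/hcl_ind=> x; elim/hcl_ind=> y; elim/hcl_ind=> z.
by rewrite !hmulE; apply/hcl_eq/hc_mulA.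
Qed.

Lemma hmul1l : left_id (hscal 1) hmul.
Proof. by elim/hcl_ind=> x; rewrite hmulE; apply/hcl_eq/hc_mul1l. Qed.

Lemma hmul1r : right_id (hscal 1) hmul.
Proof. by elim/hcl_ind=> x; rewrite hmulE; apply/hcl_eq/hc_mul1r. Qed.

Lemma hmulDl : left_distributive hmul hadd.
Proof.
elim/hcl_ind=> x; elim/hcl_ind=> y; elim/hcl_ind=> z.
by rewrite !(haddE, hmulE); apply/hcl_eq/hc_mulDl.
Qed.

Lemma hmulDr : right_distributive hmul hadd.
Proof.
elim/hcl_ind=> x; elim/hcl_ind=> y; elim/hcl_ind=> z.
by rewrite !(haddE, hmulE); apply/hcl_eq/hc_mulDr.
Qed.

Definition zero_op (_ : 'I_n.-1) : {linear F^o -> F^o} :=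
  GRing.Linear.clone _ _ _ _ (\0 : F^o -> F^o) _.

Lemma zero_op_rel : hecke_rel zero_op.
Proof. by split. Qed.

Lemma hecke_1neq0 : hscal 1 != hscal 0.
Proof.
apply/eqP=> /(@eqmodP _ hcong_equiv)/asboolP/(heval_cong zero_op_rel)/(_ 1).
by move=> /= /eqP; rewrite scale1r scale0r oner_eq0.
Qed.

HB.instance Definition _ := GRing.isNzRing.Build hecke
  haddA haddC hadd0 haddN hmulA hmul1l hmul1r hmulDl hmulDr hecke_1neq0.

Definition hscale (a : F) (x : hecke) : hecke := hscal a * x.

Lemma hscalM a b : hscal (a * b) = hscal a * hscal b.
Proof. by rewrite [RHS]hmulE; apply/hcl_eq/hc_scalM. Qed.

Lemma hscalC a x : hscal a * x = x * hscal a.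
Proof.
elim/hcl_ind: x => x.
by rewrite [LHS]hmulE [RHS]hmulE; apply/hcl_eq/hc_scalC.
Qed.

Lemma hscaleA a b x : hscale a (hscale b x) = hscale (a * b) x.
Proof. by rewrite /hscale hscalM mulrA. Qed.

Lemma hscale1 : left_id 1 hscale.
Proof. by move=> x; apply: hmul1l. Qed.

Lemma hscaleDr : right_distributive hscale +%R.
Proof. by move=> a x y; apply: mulrDr. Qed.

Lemma hscaleDl x : {morph hscale^~ x : a b / a + b}.
Proof.
move=> a b; rewrite /hscale -mulrDl; congr (_ * _).
by rewrite [RHS]haddE; apply/hcl_eq/hc_scalD.
Qed.

HB.instance Definition _ := GRing.Zmodule_isLmodule.Build F hecke
  hscaleA hscale1 hscaleDr hscaleDl.

Lemma hscaleAl (a : F) (x y : hecke) : a *: (x * y) = a *: x * y.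
Proof. exact: mulrA. Qed.

HB.instance Definition _ := GRing.Lmodule_isLalgebra.Build F hecke hscaleAl.

Lemma hscaleAr (a : F) (x y : hecke) : a *: (x * y) = x * (a *: y).
Proof. by rewrite -[a *: y]/(hscal a * y) mulrA -hscalC -mulrA. Qed.

HB.instance Definition _ := GRing.Lalgebra_isAlgebra.Build F hecke hscaleAr.

Definition hgen (i : 'I_n.-1) : hecke := hcl (HGen i).

End Hecke.

Inductive gen_subalg (F : pzRingType) (A : algType F) (S : A -> Prop) :
  A -> Prop :=
| gs_gen x : S x -> gen_subalg S x
| gs_scal a : gen_subalg S a%:A
| gs_add x y : gen_subalg S x -> gen_subalg S y -> gen_subalg S (x + y)
| gs_mul x y : gen_subalg S x -> gen_subalg S y -> gen_subalg S (x * y).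

Section Parabolic.
Variables (F : fieldType) (m n : nat).

(* [hgen F i] is pi_(i+1), so i.+1 != m leaves out pi_m. *)
Definition in_parabolic : {pred hecke F (m + n)} := fun x =>
  `[< gen_subalg
        (fun y => exists2 i : 'I_(m + n).-1, i.+1 != m & y = hgen F i) x >].

Lemma in_parabolic_subalg : GRing.subalg_closed in_parabolic.
Proof.
split=> [|a x y /asboolP px /asboolP py|x y /asboolP px /asboolP py];
  apply/asboolP.
- by rewrite -[1]scale1r; apply: gs_scal.
- apply: gs_add => //; rewrite -[x]mul1r scalerAl; apply: gs_mul => //.
  exact: gs_scal.
- exact: gs_mul.
Qed.

Definition hecke_par : Type := {x : hecke F (m + n) | in_parabolic x}.
HB.instance Definition _ := SubChoice.on hecke_par.
HB.instance Definition _ :=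
  GRing.SubChoice_isSubAlgebra.Build F (hecke F (m + n)) in_parabolic hecke_par
    in_parabolic_subalg.

Definition par_incl : {rmorphism hecke_par -> hecke F (m + n)} :=
  GRing.RMorphism.clone _ _ (val : hecke_par -> hecke F (m + n)) _.

End Parabolic.

Definition lmod_iso (R : pzRingType) (U V : lmodType R) : Prop :=
  exists f : {linear U -> V}, bijective f.

Section Restriction.
Variables (A B : pzRingType) (phi : {rmorphism B -> A}) (M : lmodType A).

Definition restriction_along of phantom (B -> A) phi : Type := M.
Definition restriction := restriction_along (Phantom _ (phi : B -> A)).

HB.instance Definition _ := GRing.Zmodule.copy restriction M.

Definition res_scale (b : B) (v : restriction) : restriction :=
  phi b *: (v : M).

Lemma res_scaleA a b v : res_scale a (res_scale b v) = res_scale (a * b) v.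
Proof. by rewrite /res_scale scalerA rmorphM. Qed.

Lemma res_scale1 : left_id 1 res_scale.
Proof. by move=> v; rewrite /res_scale rmorph1 scale1r. Qed.

Lemma res_scaleDr : right_distributive res_scale +%R.
Proof. by move=> a u v; apply: scalerDr. Qed.

Lemma res_scaleDl v : {morph res_scale^~ v : a b / a + b}.
Proof. by move=> a b; rewrite /res_scale rmorphD scalerDl. Qed.

HB.instance Definition _ := GRing.Zmodule_isLmodule.Build B restriction
  res_scaleA res_scale1 res_scaleDr res_scaleDl.

End Restriction.

Section DirectSum.
Variables (R : pzRingType) (I : finType) (M : I -> lmodType R).

Definition dsum : Type := {dffun forall i, M i}.
HB.instance Definition _ := Choice.on dsum.

Implicit Types u v w : dsum.

Definition dsum0 : dsum := [ffun i => (0 : M i)].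
Definition dsumN u : dsum := [ffun i => - u i].
Definition dsumD u v : dsum := [ffun i => u i + v i].
Definition dsumZ (a : R) u : dsum := [ffun i => a *: u i].

Lemma dsumDA : associative dsumD.
Proof. by move=> u v w; apply/ffunP=> i; rewrite !ffunE addrA. Qed.
Lemma dsumDC : commutative dsumD.
Proof. by move=> u v; apply/ffunP=> i; rewrite !ffunE addrC. Qed.
Lemma dsumD0 : left_id dsum0 dsumD.
Proof. by move=> u; apply/ffunP=> i; rewrite !ffunE add0r. Qed.
Lemma dsumDN : left_inverse dsum0 dsumN dsumD.
Proof. by move=> u; apply/ffunP=> i; rewrite !ffunE addNr. Qed.

HB.instance Definition _ :=
  GRing.isZmodule.Build dsum dsumDA dsumDC dsumD0 dsumDN.

Lemma dsumZA a b u : dsumZ a (dsumZ b u) = dsumZ (a * b) u.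
Proof. by apply/ffunP=> i; rewrite !ffunE scalerA. Qed.
Lemma dsumZ1 : left_id 1 dsumZ.
Proof. by move=> u; apply/ffunP=> i; rewrite !ffunE scale1r. Qed.
Lemma dsumZDr : right_distributive dsumZ +%R.
Proof. by move=> a u v; apply/ffunP=> i; rewrite !ffunE scalerDr. Qed.
Lemma dsumZDl u : {morph dsumZ^~ u : a b / a + b}.
Proof. by move=> a b; apply/ffunP=> i; rewrite !ffunE scalerDl. Qed.

HB.instance Definition _ :=
  GRing.Zmodule_isLmodule.Build R dsum dsumZA dsumZ1 dsumZDr dsumZDl.

End DirectSum.

Section HeckeModule.
Variables (F : fieldType) (n : nat) (V : lmodType F).
Variables (op : 'I_n.-1 -> {linear V -> V}) (rop : hecke_rel op).

(* V with pi_i acting as [op i]; see [hgen_hmod] and [scal_hmod]. *)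
Definition hmod_along of hecke_rel op : Type := V.
Definition hmod := hmod_along rop.

HB.instance Definition _ := GRing.Zmodule.copy hmod V.

Definition hmod_scale (h : hecke F n) (v : hmod) : hmod :=
  heval op (hrep h) (v : V).

Lemma hmod_scaleE t v : hmod_scale (hcl t) v = heval op t v.
Proof. by apply: heval_cong => //; apply: hrep_cong. Qed.

Lemma hmod_scaleA a b v : hmod_scale a (hmod_scale b v) = hmod_scale (a * b) v.
Proof.
elim/hcl_ind: a => s; elim/hcl_ind: b => t.
by rewrite [_ * _]hmulE !hmod_scaleE.
Qed.

Lemma hmod_scale1 : left_id 1 hmod_scale.
Proof. by move=> v; rewrite hmod_scaleE /= scale1r. Qed.

Lemma hmod_scaleDr : right_distributive hmod_scale +%R.
Proof. by move=> a u v; apply: hevalD. Qed.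

Lemma hmod_scaleDl v : {morph hmod_scale^~ v : a b / a + b}.
Proof.
elim/hcl_ind=> s; elim/hcl_ind=> t.
by rewrite [_ + _]haddE !hmod_scaleE.
Qed.

HB.instance Definition _ := GRing.Zmodule_isLmodule.Build (hecke F n) hmod
  hmod_scaleA hmod_scale1 hmod_scaleDr hmod_scaleDl.

Lemma hgen_hmod i (v : hmod) : hgen F i *: v = op i v.
Proof. exact: hmod_scaleE. Qed.

Lemma scal_hmod (a : F) (v : hmod) : (a%:A : hecke F n) *: v = a *: (v : V).
Proof.
suff -> : (a%:A : hecke F n) = hcl (HScal a) by apply: hmod_scaleE.
exact: mulr1.
Qed.

End HeckeModule.

Section FreeModule.
Variables (F : fieldType) (X : finType).
Definition delta (x : X) : {ffun X -> F^o} := [ffun y => (y == x)%:R].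

Lemma ffun_delta (v : {ffun X -> F^o}) : v = \sum_x v x *: delta x.
Proof.
apply/ffunP=> y; rewrite sum_ffunE (bigD1 y) //= big1 => [|x xy].
  by rewrite !ffunE eqxx [_ *: _]mulr1 addr0.
by rewrite !ffunE eq_sym (negPf xy) [_ *: _]mulr0.
Qed.

Lemma lin_delta (f : {linear {ffun X -> F^o} -> {ffun X -> F^o}}) v x :
  f v x = \sum_y v y * f (delta y) x.
Proof.
rewrite {1}(ffun_delta v) linear_sum sum_ffunE.
by apply: eq_bigr => y _; rewrite linearZ ffunE.
Qed.

End FreeModule.

Section OuterTensor.
Variables (F : fieldType) (X Y : finType).

(* The tensor product over F of the vector spaces F^X and F^Y with bases X and
   Y is the vector space F^(X * Y) with basis X * Y. *)
Definition pure_tensor (u : {ffun X -> F^o}) (v : {ffun Y -> F^o}) :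
  {ffun X * Y -> F^o} := [ffun p => u p.1 * v p.2].

(* f (x) id and id (x) g, see [tensl_pure] and [tensr_pure] *)
Definition tensl_fun (f : {linear {ffun X -> F^o} -> {ffun X -> F^o}})
  (w : {ffun X * Y -> F^o}) : {ffun X * Y -> F^o} :=
  [ffun p => f [ffun x => w (x, p.2)] p.1].
Definition tensr_fun (g : {linear {ffun Y -> F^o} -> {ffun Y -> F^o}})
  (w : {ffun X * Y -> F^o}) : {ffun X * Y -> F^o} :=
  [ffun p => g [ffun y => w (p.1, y)] p.2].

Lemma tensl_pure f u v : tensl_fun f (pure_tensor u v) = pure_tensor (f u) v.
Proof.
apply/ffunP=> p; rewrite !ffunE.
have -> : [ffun x => pure_tensor u v (x, p.2)] = v p.2 *: u.
  by apply/ffunP=> x; rewrite !ffunE /= mulrC.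
by rewrite linearZ ffunE mulrC.
Qed.

Lemma tensr_pure g u v : tensr_fun g (pure_tensor u v) = pure_tensor u (g v).
Proof.
apply/ffunP=> p; rewrite !ffunE.
have -> : [ffun y => pure_tensor u v (p.1, y)] = u p.1 *: v.
  by apply/ffunP=> y; rewrite !ffunE.
by rewrite linearZ ffunE.
Qed.

Lemma tensl_linear f : linear (tensl_fun f).
Proof.
move=> a u v; apply/ffunP=> p; rewrite !ffunE.
have -> : [ffun x => (a *: u + v) (x, p.2)] =
    a *: [ffun x => u (x, p.2)] + [ffun x => v (x, p.2)].
  by apply/ffunP=> x; rewrite !ffunE.
by rewrite linearP !ffunE.
Qed.

Lemma tensr_linear g : linear (tensr_fun g).
Proof.
move=> a u v; apply/ffunP=> p; rewrite !ffunE.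
have -> : [ffun x => (a *: u + v) (p.1, x)] =
    a *: [ffun x => u (p.1, x)] + [ffun x => v (p.1, x)].
  by apply/ffunP=> x; rewrite !ffunE.
by rewrite linearP !ffunE.
Qed.

HB.instance Definition _ f :=
  GRing.isLinear.Build F {ffun X * Y -> F^o} {ffun X * Y -> F^o} *:%R (tensl_fun f)
    (tensl_linear f).
HB.instance Definition _ g :=
  GRing.isLinear.Build F {ffun X * Y -> F^o} {ffun X * Y -> F^o} *:%R (tensr_fun g)
    (tensr_linear g).

Definition tensl f : {linear {ffun X * Y -> F^o} -> {ffun X * Y -> F^o}} :=
  GRing.Linear.clone _ _ _ _ (tensl_fun f) _.
Definition tensr g : {linear {ffun X * Y -> F^o} -> {ffun X * Y -> F^o}} :=
  GRing.Linear.clone _ _ _ _ (tensr_fun g) _.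
Definition tens0 : {linear {ffun X * Y -> F^o} -> {ffun X * Y -> F^o}} :=
  GRing.Linear.clone _ _ _ _ (\0 : {ffun X * Y -> F^o} -> {ffun X * Y -> F^o}) _.

Lemma tensl_slice f w y :
  [ffun x => tensl f w (x, y)] = f [ffun x => w (x, y)].
Proof. by apply/ffunP=> x; rewrite !ffunE. Qed.

Lemma tensr_slice g w x :
  [ffun y => tensr g w (x, y)] = g [ffun y => w (x, y)].
Proof. by apply/ffunP=> y; rewrite !ffunE. Qed.

Lemma tensl_comp f1 f2 w p :
  tensl f1 (tensl f2 w) p = f1 (f2 [ffun x => w (x, p.2)]) p.1.
Proof. by rewrite ffunE tensl_slice. Qed.

Lemma tensr_comp g1 g2 w p :
  tensr g1 (tensr g2 w) p = g1 (g2 [ffun y => w (p.1, y)]) p.2.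
Proof. by rewrite ffunE tensr_slice. Qed.

Lemma tenslr f g w : tensl f (tensr g w) = tensr g (tensl f w).
Proof.
apply/ffunP=> -[x y]; rewrite !ffunE /= (lin_delta f) (lin_delta g).
under eq_bigr => x' _ do rewrite !ffunE /= (lin_delta g) mulr_suml.
rewrite exchange_big; apply: eq_bigr => y' _ /=.
rewrite !ffunE /= (lin_delta f) mulr_suml; apply: eq_bigr => x' _.
by rewrite !ffunE mulrAC.
Qed.

Variables (m n : nat).
Variables (f : 'I_m.-1 -> {linear {ffun X -> F^o} -> {ffun X -> F^o}}).
Variables (g : 'I_n.-1 -> {linear {ffun Y -> F^o} -> {ffun Y -> F^o}}).

(* The isomorphism of H_{m,n}(0) with H_m(0) (x) H_n(0) maps pi_i to
   pi_i (x) 1 for i < m and pi_(m+j) to 1 (x) pi_j.  The value 0 for pi_m (which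
   is not in H_{m,n}(0)) extends the action to H_{m+n}(0), so that the action of
   the subalgebra H_{m,n}(0) is obtained from it by restriction. *)
Definition tens_op (i : 'I_(m + n).-1) :
    {linear {ffun X * Y -> F^o} -> {ffun X * Y -> F^o}} :=
  if insub (i : nat) : option 'I_m.-1 is Some j then tensl (f j)
  else if (m <= i)%N then
    if insub (i - m)%N : option 'I_n.-1 is Some j then tensr (g j) else tens0
  else tens0.

Variant tens_op_spec (i : nat) :
    {linear {ffun X * Y -> F^o} -> {ffun X * Y -> F^o}} -> Prop :=
| TensOpL (j : 'I_m.-1) of i = nat_of_ord j : tens_op_spec i (tensl (f j))
| TensOpR (j : 'I_n.-1) of i = (m + j)%N : tens_op_spec i (tensr (g j))
| TensOp0 of i.+1 = m : tens_op_spec i tens0.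

Lemma tens_opP (i : 'I_(m + n).-1) : tens_op_spec i (tens_op i).
Proof.
rewrite /tens_op; case: insubP => [j _ ji|]; first exact: TensOpL.
rewrite -leqNgt => mi; have im := ltn_ord i.
case: leqP => [lemi|ltim]; last by apply: TensOp0; lia.
by case: insubP => [j _ ji|]; [apply: TensOpR; rewrite ji; lia | lia].
Qed.

Hypotheses (rf : hecke_rel f) (rg : hecke_rel g).

Lemma tens_rel : hecke_rel tens_op.
Proof.
case: rf => fi fb fc; case: rg => gi gb gc; split.
- move=> i w; case: tens_opP => [j _|j _|//]; apply/ffunP=> -[x y].
    by rewrite tensl_comp fi ffunE.
  by rewrite tensr_comp gi ffunE.
- move=> i j w; case: tens_opP => [i' ->|i' ->|im];
    case: tens_opP => [j' ->|j' ->|jm] e //;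
    have := ltn_ord i; have := ltn_ord j;
    try (have := ltn_ord i'); try (have := ltn_ord j'); try lia; move=> *.
  - by apply/ffunP=> -[x y]; rewrite !ffunE !tensl_slice fb.
  - exact: (linear0 (tensl (f i'))).
  - by apply/ffunP=> -[x y]; rewrite !ffunE !tensr_slice gb //; lia.
  - exact: (esym (linear0 (tensr (g j')))).
- move=> i j w; case: tens_opP => [i' ->|i' ->|im];
    case: tens_opP => [j' ->|j' ->|jm] e //.
  - by apply/ffunP=> -[x y]; rewrite !tensl_comp fc.
  - exact: tenslr.
  - exact: (linear0 (tensl (f i'))).
  - exact/esym/tenslr.
  - by apply/ffunP=> -[x y]; rewrite !tensr_comp gc //; lia.
  - exact: (linear0 (tensr (g i'))).
  - exact: (esym (linear0 (tensl (f j')))).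
  - exact: (esym (linear0 (tensr (g j')))).
Qed.

Definition outer_tensor : lmodType (hecke_par F m n) :=
  restriction (par_incl F m n) (hmod tens_rel).

Lemma outer_tensor_left (h : hecke_par F m n) (i : 'I_(m + n).-1) (j : 'I_m.-1)
    u v : par_incl F m n h = hgen F i -> i = j :> nat ->
  h *: (pure_tensor u v : outer_tensor) = pure_tensor (f j u) v.
Proof.
move=> hi ij; transitivity (tens_op i (pure_tensor u v)).
  by rewrite -(@hgen_hmod _ _ _ _ tens_rel) -hi.
case: tens_opP => [j' ij'|j' ij'|im]; last 2 first.
- by have := ltn_ord j; lia.
- by have := ltn_ord j; lia.
by rewrite [LHS]tensl_pure; congr (pure_tensor (f _ _) _); apply: ord_inj; lia.
Qed.

Lemma outer_tensor_right (h : hecke_par F m n) (i : 'I_(m + n).-1)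
    (j : 'I_n.-1) u v : par_incl F m n h = hgen F i -> i = (m + j)%N :> nat ->
  h *: (pure_tensor u v : outer_tensor) = pure_tensor u (g j v).
Proof.
move=> hi ij; transitivity (tens_op i (pure_tensor u v)).
  by rewrite -(@hgen_hmod _ _ _ _ tens_rel) -hi.
case: tens_opP => [j' ij'|j' ij'|im]; last 1 first.
- by lia.
- by have := ltn_ord j'; lia.
by rewrite [LHS]tensr_pure; congr (pure_tensor _ (g _ _)); apply: ord_inj; lia.
Qed.

End OuterTensor.

(* A box is (row, column), rows being numbered from bottom to top. *)
Definition box : Type := (nat * nat)%type.

(* A diagram is given by the list of its boxes; those of a generalized ribbon
   are listed from southwest to northeast, so that a next box is either to the
   right of, or above the previous one (in the same connected component), or
   strictly northeast of it (the first box of the next component). *)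
Definition diagram : Type := seq box.

Definition right_of (b : box) : box := (b.1, b.2.+1).
Definition above (b : box) : box := (b.1.+1, b.2).
Definition northeast (b b' : box) : bool := (b.1 < b'.1)%N && (b.2 < b'.2)%N.

Definition ribbon_step (b b' : box) : bool :=
  [|| b' == right_of b, b' == above b | northeast b b'].

Definition generalized_ribbon (D : diagram) : bool := sorted ribbon_step D.

(* The ribbon diagram of a composition, with first box at (r, c). *)
Fixpoint ribbon_at (r c : nat) (a : seq nat) : diagram :=
  if a is x :: a' then
    [seq (r, c + j)%N | j <- iota 0 x] ++ ribbon_at r.+1 (c + x.-1) a'
  else [::].
Definition ribbon (a : seq nat) : diagram := ribbon_at 0 0 a.

(* The connected components of a generalized ribbon, as compositions. *)
Fixpoint components (D : diagram) : seq (seq nat) :=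
  if D is b :: D' then
    if D' is b' :: _ then
      match components D' with
      | (x :: a) :: s =>
          if b' == right_of b then (x.+1 :: a) :: s
          else if b' == above b then (1%N :: x :: a) :: s
          else [:: 1%N] :: (x :: a) :: s
      | s => s (* does not occur *)
      end
    else [:: [:: 1%N]]
  else [::].

(* alpha |> beta, the near concatenation, which joins the two middle rows. *)
Fixpoint near_cat (a b : seq nat) : seq nat :=
  match a, b with
  | [:: x], y :: b' => (x + y)%N :: b'
  | x :: a', _ => x :: near_cat a' b
  | [::], _ => b
  end.

(* [alpha^1 (+) ... (+) alpha^k], from the list of the alpha^i. *)
Definition bracket (s : seq (seq nat)) : seq (seq nat) :=
  if s is a :: s' then
    foldl (fun B c => [seq b ++ c | b <- B] ++ [seq near_cat b c | b <- B])
      [:: a] s'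
  else [:: [::]].

Section Tableaux.
Variables (N : nat) (D : diagram).

Definition box_at (p : 'I_(size D)) : box := tnth (in_tuple D) p.

(* b is to the left of b' in its row, or above b' in its column *)
Definition precedes (b b' : box) : bool :=
  (b.1 == b'.1) && (b.2 < b'.2)%N || (b.2 == b'.2) && (b'.1 < b.1)%N.

(* Fillings by 'I_N: the entry k : 'I_N stands for k + 1. *)
Definition standard (t : {ffun 'I_(size D) -> 'I_N}) : bool :=
  [&& injectiveb t, [forall k, exists p, t p == k]
    & [forall p, forall q, precedes (box_at p) (box_at q) ==> (t p < t q)%N]].

Record tableau := Tableau
  { entry :> {ffun 'I_(size D) -> 'I_N}; _ : standard entry }.

HB.instance Definition _ := [isSub for entry].
HB.instance Definition _ := [Finite of tableau by <:].

Definition row_of (t : tableau) (k : 'I_N) : nat :=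
  if [pick p | t p == k] is Some p then (box_at p).1 else 0%N.

(* The entries exchanged by s_(i+1), i.e. i+1 and i+2, numbered from 0. *)
Lemma hi_proof (i : 'I_N.-1) : (i.+1 < N)%N.
Proof. by have := ltn_ord i; lia. Qed.
Definition lo (i : 'I_N.-1) : 'I_N := Ordinal (ltnW (hi_proof i)).
Definition hi (i : 'I_N.-1) : 'I_N := Ordinal (hi_proof i).

(* This is standard whenever lo i is in a lower row than hi i, see [swapE]. *)
Definition swap (i : 'I_N.-1) (t : tableau) : tableau :=
  insubd t [ffun p => tperm (lo i) (hi i) (t p)].

Lemma entry_inj (t : tableau) : injective t.
Proof. by case: t => t /= /and3P[/injectiveP]. Qed.

Lemma entry_surj (t : tableau) k : exists p, t p = k.
Proof.
by case: t => t /= /and3P[_ /forallP/(_ k)/existsP[p /eqP]]; exists p.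
Qed.

Lemma entry_lt (t : tableau) p q :
  precedes (box_at p) (box_at q) -> (t p < t q)%N.
Proof.
by case: t => t /= /and3P[_ _ /forallP/(_ p)/forallP/(_ q)/implyP].
Qed.

Lemma row_of_entry (t : tableau) p : row_of t (t p) = (box_at p).1.
Proof.
rewrite /row_of; case: pickP => [q /eqP/entry_inj -> //|/(_ p)].
by rewrite eqxx.
Qed.

Lemma swapE i t : (row_of t (lo i) < row_of t (hi i))%N ->
  forall p, swap i t p = tperm (lo i) (hi i) (t p).
Proof.
move=> lt p; rewrite /swap insubdK ?ffunE // -topredE /=; apply/and3P; split.
- by apply/injectiveP=> q r; rewrite !ffunE => /perm_inj/entry_inj.
- apply/forallP=> k; apply/existsP.
  have [q tq] := entry_surj t (tperm (lo i) (hi i) k).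
  by exists q; rewrite ffunE tq tpermK.
- apply/forallP=> q; apply/forallP=> r; apply/implyP=> qr.
  rewrite !ffunE; have := entry_lt t qr.
  case: (tpermP _ _ (t q)) => [q1|q1|/eqP q1 /eqP q2];
    case: (tpermP _ _ (t r)) => [r1|r1|/eqP r1 /eqP r2];
    rewrite ?q1 ?r1 //=; try lia;
    try (move: q1 q2 || move: r1 r2); rewrite -?val_eqE /=; try lia.
  + move=> _; move: lt; rewrite -q1 -r1 !row_of_entry; move: qr.
    by rewrite /precedes; lia.
Qed.

Lemma row_swap i t : (row_of t (lo i) < row_of t (hi i))%N ->
  forall k, row_of (swap i t) k = row_of t (tperm (lo i) (hi i) k).
Proof.
move=> lt k; have [p tp] := entry_surj (swap i t) k.
by rewrite -[in LHS]tp row_of_entry -tp swapE // tpermK row_of_entry.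
Qed.

End Tableaux.

Section TableauModule.
Variables (F : fieldType) (N : nat) (D : diagram).
Local Notation tab := (tableau N D).
Local Notation V := {ffun tab -> F^o}.
Local Notation e := (@delta F tab).

(* The operator pi_(i+1) - 1 on basis vectors. *)
Definition pibar (i : 'I_N.-1) (t : tab) : V :=
  if (row_of t (hi i) < row_of t (lo i))%N then - e t
  else if row_of t (lo i) == row_of t (hi i) then 0
  else e (swap i t).

Definition pi_fun (i : 'I_N.-1) (v : V) : V := v + \sum_t v t *: pibar i t.

Lemma pi_linear i : linear (pi_fun i).
Proof.
move=> a u v; rewrite /pi_fun scalerDr addrACA; congr (_ + _).
rewrite scaler_sumr -big_split; apply: eq_bigr => t _ /=.
by rewrite !ffunE scalerDl scalerA.
Qed.

HB.instance Definition _ i :=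
  GRing.isLinear.Build F V V *:%R (pi_fun i) (pi_linear i).

Definition pi_op (i : 'I_N.-1) : {linear V -> V} :=
  GRing.Linear.clone _ _ _ _ (pi_fun i) _.

Lemma pi_opE i t : pi_op i (e t) = e t + pibar i t.
Proof.
rewrite /= /pi_fun; congr (_ + _); rewrite (bigD1 t) //= big1 => [|s st].
  by rewrite ffunE eqxx scale1r addr0.
by rewrite ffunE (negPf st) scale0r.
Qed.

Lemma pi_gt i t : (row_of t (hi i) < row_of t (lo i))%N -> pi_op i (e t) = 0.
Proof. by move=> lt; rewrite pi_opE /pibar lt addrN. Qed.

Lemma pi_eq i t : row_of t (lo i) = row_of t (hi i) -> pi_op i (e t) = e t.
Proof. by move=> eq; rewrite pi_opE /pibar eq ltnn eqxx addr0. Qed.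

Lemma pi_lt i t : (row_of t (lo i) < row_of t (hi i))%N ->
  pi_op i (e t) = e t + e (swap i t).
Proof. by move=> lt; rewrite pi_opE /pibar ltnNge (ltnW lt) /= ltn_eqF. Qed.

End TableauModule.

Lemma addr6 (V : zmodType) (x a b c d f : V) :
  x + a + (b + c) + (d + f) = x + b + (a + d) + (c + f).
Proof. by rewrite (addrACA x a) -(addrA (x + b)) (addrACA a c) addrA. Qed.

Section TableauRelations.
Variables (F : fieldType) (N : nat) (D : diagram).
Local Notation tab := (tableau N D).
Local Notation V := {ffun tab -> F^o}.
Local Notation e := (@delta F tab).
Variable op : 'I_N.-1 -> {linear V -> V}.
Hypothesis op_gt : forall i t,
  (row_of t (hi i) < row_of t (lo i))%N -> op i (e t) = 0.
Hypothesis op_eq : forall i t,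
  row_of t (lo i) = row_of t (hi i) -> op i (e t) = e t.
Hypothesis op_lt : forall i t,
  (row_of t (lo i) < row_of t (hi i))%N -> op i (e t) = e t + e (swap i t).

Lemma lin_ext (f g : {linear V -> V}) :
  (forall t, f (e t) = g (e t)) -> f =1 g.
Proof.
move=> fg v; rewrite (ffun_delta v) !linear_sum; apply: eq_bigr => t _.
by rewrite !linearZ fg.
Qed.

Lemma swap_lo i (t : tab) : (row_of t (lo i) < row_of t (hi i))%N ->
  row_of (swap i t) (lo i) = row_of t (hi i).
Proof. by move=> lt; rewrite row_swap // tpermL. Qed.

Lemma swap_hi i (t : tab) : (row_of t (lo i) < row_of t (hi i))%N ->
  row_of (swap i t) (hi i) = row_of t (lo i).
Proof. by move=> lt; rewrite row_swap // tpermR. Qed.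

Lemma swap_out i (t : tab) k : (row_of t (lo i) < row_of t (hi i))%N ->
  lo i != k -> hi i != k -> row_of (swap i t) k = row_of t k.
Proof. by move=> lt *; rewrite row_swap // tpermD. Qed.

Lemma op0 i : op i 0 = 0.
Proof. exact: linear0. Qed.

Lemma opD i u v : op i (u + v) = op i u + op i v.
Proof. exact: linearD. Qed.

Lemma op_idem i v : op i (op i v) = op i v.
Proof.
pose f : {linear V -> V} := GRing.Linear.clone _ _ _ _ (op i \o op i) _.
apply: (@lin_ext f (op i)) => t.
change (op i (op i (e t)) = op i (e t)).
case: (ltngtP (row_of t (lo i)) (row_of t (hi i))) => [lt|gt|eq].
- by rewrite (op_lt lt) opD (op_lt lt) op_gt ?addr0 // swap_lo // swap_hi.
- by rewrite (op_gt gt) op0.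
- by rewrite !op_eq.
Qed.

Lemma op_comm (i j : 'I_N.-1) v : (i.+1 < j)%N ->
  op i (op j v) = op j (op i v).
Proof.
move=> ij.
pose f : {linear V -> V} := GRing.Linear.clone _ _ _ _ (op i \o op j) _.
pose g : {linear V -> V} := GRing.Linear.clone _ _ _ _ (op j \o op i) _.
apply: (@lin_ext f g) => t.
change (op i (op j (e t)) = op j (op i (e t))).
have [n1 n2 n3 n4] :
    [/\ lo i != lo j, lo i != hi j, hi i != lo j & hi i != hi j].
  by rewrite -!val_eqE /=; split; lia.
have [m1 m2 m3 m4] :
    [/\ lo j != lo i, lo j != hi i, hi j != lo i & hi j != hi i].
  by rewrite -!val_eqE /=; split; lia.
case: (ltngtP (row_of t (lo i)) (row_of t (hi i))) => [lt|gt|eq];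
  case: (ltngtP (row_of t (lo j)) (row_of t (hi j))) => [lt'|gt'|eq'].
- have swapC : swap i (swap j t) = swap j (swap i t).
    apply/val_inj/ffunP => p; rewrite !swapE ?swap_out //.
    rewrite [LHS]inj_tperm; last exact: perm_inj.
    by rewrite (tpermD n1 n3) (tpermD n2 n4).
  rewrite (op_lt lt) (op_lt lt') !opD (op_lt lt) (op_lt lt').
  rewrite (@op_lt i (swap j t)); last by rewrite !swap_out.
  rewrite (@op_lt j (swap i t)); last by rewrite !swap_out.
  by rewrite addrACA swapC.
- by rewrite (op_gt gt') op0 (op_lt lt) opD !op_gt ?swap_out // addr0.
- by rewrite (op_eq eq') (op_lt lt) opD (op_eq eq') op_eq ?swap_out.
- by rewrite (op_gt gt) op0 (op_lt lt') opD !op_gt ?swap_out // addr0.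
- by rewrite !op_gt // !op0.
- by rewrite (op_gt gt) (op_eq eq') (op_gt gt) op0.
- by rewrite (op_eq eq) (op_lt lt') opD !op_eq ?swap_out.
- by rewrite (op_gt gt') (op_eq eq) (op_gt gt') op0.
- by rewrite !op_eq.
Qed.

Lemma op_braid (i j : 'I_N.-1) v : j = i.+1 :> nat ->
  op i (op j (op i v)) = op j (op i (op j v)).
Proof.
move=> ij.
pose f : {linear V -> V} :=
  GRing.Linear.clone _ _ _ _ (op i \o (op j \o op i)) _.
pose g : {linear V -> V} :=
  GRing.Linear.clone _ _ _ _ (op j \o (op i \o op j)) _.
apply: (@lin_ext f g) => t.
change (op i (op j (op i (e t))) = op j (op i (op j (e t)))).
have hl : hi i = lo j by apply: val_inj.
have n1 : lo i != hi j by rewrite -!val_eqE /=; lia.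
have n2 : lo i != lo j by rewrite -!val_eqE /=; lia.
have n3 : hi j != lo j by rewrite -!val_eqE /=; lia.
have si1 (s : tab) : (row_of s (lo i) < row_of s (lo j))%N ->
    row_of (swap i s) (lo i) = row_of s (lo j).
  by rewrite -hl; apply: swap_lo.
have si2 (s : tab) : (row_of s (lo i) < row_of s (lo j))%N ->
    row_of (swap i s) (lo j) = row_of s (lo i).
  by rewrite -hl; apply: swap_hi.
have si3 (s : tab) : (row_of s (lo i) < row_of s (lo j))%N ->
    row_of (swap i s) (hi j) = row_of s (hi j).
  by move=> lt; rewrite swap_out ?hl // eq_sym.
have sj1 (s : tab) : (row_of s (lo j) < row_of s (hi j))%N ->
    row_of (swap j s) (lo i) = row_of s (lo i).
  by move=> lt; rewrite swap_out // eq_sym.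
have sj2 := @swap_lo j; have sj3 := @swap_hi j.
pose R (s : tab) a b c :=
  [/\ row_of s (lo i) = a, row_of s (lo j) = b & row_of s (hi j) = c].
have ri s a b c : R s a b c -> (a < b)%N -> R (swap i s) b a c.
  by move=> [<- <- <-] lt; split; [apply: si1|apply: si2|apply: si3].
have rj s a b c : R s a b c -> (b < c)%N -> R (swap j s) a c b.
  by move=> [<- <- <-] lt; split; [apply: sj1|apply: sj2|apply: sj3].
have ig s a b c : R s a b c -> (b < a)%N -> op i (e s) = 0.
  by move=> [<- <- _]; rewrite -hl; apply: op_gt.
have ie s a b c : R s a b c -> a = b -> op i (e s) = e s.
  by move=> [<- <- _]; rewrite -hl; apply: op_eq.
have il s a b c : R s a b c -> (a < b)%N -> op i (e s) = e s + e (swap i s).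
  by move=> [<- <- _]; rewrite -hl; apply: op_lt.
have jg s a b c : R s a b c -> (c < b)%N -> op j (e s) = 0.
  by move=> [_ <- <-]; apply: op_gt.
have je s a b c : R s a b c -> b = c -> op j (e s) = e s.
  by move=> [_ <- <-]; apply: op_eq.
have jl s a b c : R s a b c -> (b < c)%N -> op j (e s) = e s + e (swap j s).
  by move=> [_ <- <-]; apply: op_lt.
have : R t (row_of t (lo i)) (row_of t (lo j)) (row_of t (hi j)) by [].
move: (row_of t (lo i)) (row_of t (lo j)) (row_of t (hi j)) => a b c T.
case: (ltngtP a b) => ab; case: (ltngtP b c) => bc.
- have ac := ltn_trans ab bc.
  have Ti := ri _ _ _ _ T ab; have Tj := rj _ _ _ _ T bc.
  have Tij := rj _ _ _ _ Ti ac; have Tji := ri _ _ _ _ Tj ac.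
  have E : swap i (swap j (swap i t)) = swap j (swap i (swap j t)).
    have [t1 t2 t3] := T; have [ti1 ti2 ti3] := Ti; have [tj1 tj2 tj3] := Tj.
    have [u1 u2 u3] := Tij; have [v1 v2 v3] := Tji.
    apply/val_inj/ffunP=> p.
    do 6! [rewrite swapE; last by rewrite ?hl ?t1 ?t2 ?t3 ?ti1 ?ti2 ?ti3 ?tj1 ?tj2 ?tj3
      ?u1 ?u2 ?u3 ?v1 ?v2 ?v3].
    rewrite hl [LHS]inj_tperm; last exact: perm_inj.
    rewrite [RHS]inj_tperm; last exact: perm_inj.
    have [m1 m2 m3] :
      [/\ hi j != lo i, lo j != lo i & lo j != hi j] by split; rewrite eq_sym.
    by rewrite !tpermK tpermR tpermL (tpermD n1 m3) (tpermD m2 m1).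
  rewrite (il _ _ _ _ T ab) (jl _ _ _ _ T bc) !opD.
  rewrite (il _ _ _ _ T ab) (jl _ _ _ _ T bc).
  rewrite (jl _ _ _ _ Ti ac) (il _ _ _ _ Tj ac) !opD.
  rewrite (il _ _ _ _ T ab) (jl _ _ _ _ T bc).
  rewrite (ig _ _ _ _ Ti ab) (jg _ _ _ _ Tj bc) !add0r.
  rewrite (jl _ _ _ _ Ti ac) (il _ _ _ _ Tj ac).
  rewrite (il _ _ _ _ Tij bc) (jl _ _ _ _ Tji ab) E.
  exact: addr6.
- have Ti := ri _ _ _ _ T ab.
  rewrite (jg _ _ _ _ T bc) !op0 (il _ _ _ _ T ab) opD (jg _ _ _ _ T bc) add0r.
  case: (ltngtP a c) => ac.
  + have Tij := rj _ _ _ _ Ti ac.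
    by rewrite (jl _ _ _ _ Ti ac) opD (ig _ _ _ _ Ti ab) (ig _ _ _ _ Tij bc) addr0.
  + by rewrite (jg _ _ _ _ Ti ac) op0.
  + by rewrite (je _ _ _ _ Ti ac) (ig _ _ _ _ Ti ab).
- have ac : (a < c)%N by rewrite -bc.
  have Ti := ri _ _ _ _ T ab; have Tij := rj _ _ _ _ Ti ac.
  rewrite (je _ _ _ _ T bc) (il _ _ _ _ T ab) !opD (je _ _ _ _ T bc).
  rewrite (jl _ _ _ _ Ti ac) !opD (il _ _ _ _ T ab) (ig _ _ _ _ Ti ab).
  by rewrite add0r (ie _ _ _ _ Tij bc) addrA.
- have Tj := rj _ _ _ _ T bc.
  rewrite (ig _ _ _ _ T ab) !op0 (jl _ _ _ _ T bc) opD (ig _ _ _ _ T ab) add0r.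
  case: (ltngtP a c) => ac.
  + have Tji := ri _ _ _ _ Tj ac.
    by rewrite (il _ _ _ _ Tj ac) opD (jg _ _ _ _ Tj bc) (jg _ _ _ _ Tji ab) addr0.
  + by rewrite (ig _ _ _ _ Tj ac) op0.
  + by rewrite (ie _ _ _ _ Tj ac) (jg _ _ _ _ Tj bc).
- by rewrite (ig _ _ _ _ T ab) (jg _ _ _ _ T bc) !op0.
- by rewrite (ig _ _ _ _ T ab) (je _ _ _ _ T bc) (ig _ _ _ _ T ab) !op0.
- have ac : (a < c)%N by rewrite ab.
  have Tj := rj _ _ _ _ T bc; have Tji := ri _ _ _ _ Tj ac.
  rewrite (ie _ _ _ _ T ab) (jl _ _ _ _ T bc) !opD (ie _ _ _ _ T ab).
  rewrite (il _ _ _ _ Tj ac) !opD (jl _ _ _ _ T bc) (jg _ _ _ _ Tj bc).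
  by rewrite add0r (je _ _ _ _ Tji ab) addrA.
- by rewrite (ie _ _ _ _ T ab) (jg _ _ _ _ T bc) !op0.
- by rewrite (ie _ _ _ _ T ab) (je _ _ _ _ T bc) (ie _ _ _ _ T ab) (je _ _ _ _ T bc).
Qed.

Lemma op_rel : hecke_rel op.
Proof.
by split=> [|i j v|i j v]; [exact: op_idem|exact: op_braid|exact: op_comm].
Qed.

End TableauRelations.

Section ProjectiveModule.
Variables (F : fieldType) (N : nat) (D : diagram).

Lemma pi_rel : hecke_rel (@pi_op F N D).
Proof. exact: op_rel (@pi_gt F N D) (@pi_eq F N D) (@pi_lt F N D). Qed.

(* P_alpha for a generalized ribbon alpha = D of size N; [Pmod_pibar] gives the
   action on tableaux. *)
Definition Pmod : lmodType (hecke F N) := hmod pi_rel.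

Lemma Pmod_pibar i (t : tableau N D) :
  (hgen F i - 1) *: (delta F t : Pmod) = pibar F i t.
Proof.
rewrite scalerBl scale1r (@hgen_hmod _ _ _ _ pi_rel) pi_opE.
have E : delta F t + pibar F i t - delta F t = pibar F i t.
  by rewrite addrAC subrr add0r.
exact: E.
Qed.

End ProjectiveModule.

Definition Ptensor (F : fieldType) (m n : nat) (beta gamma : diagram) :
    lmodType (hecke_par F m n) :=
  outer_tensor (pi_rel F m beta) (pi_rel F n gamma).

Section Decomposition.
Variables (m n : nat) (alpha : diagram).

(* A filling by the symbols beta = false < gamma = true. *)
Local Notation filling := {ffun 'I_(size alpha) -> bool}.

Definition part (f : filling) (c : bool) : diagram :=
  [seq box_at p | p <- enum 'I_(size alpha) & f p == c].

Definition is_decomposition (f : filling) : bool :=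
  [&& [forall p, forall q,
         precedes (@box_at alpha p) (box_at q) ==> (f p ==> f q)],
      size (part f false) == m & size (part f true) == n].

Record decomposition := Decomposition
  { filling_of :> filling; _ : is_decomposition filling_of }.

HB.instance Definition _ := [isSub for filling_of].
HB.instance Definition _ := [Finite of decomposition by <:].

Definition beta_part (f : decomposition) : diagram := part f false.
Definition gamma_part (f : decomposition) : diagram := part f true.

Definition ribbon_decomposition : finType :=
  {f : decomposition &
     (seq_sub (bracket (components (beta_part f)))
      * seq_sub (bracket (components (gamma_part f))))%type}.

Definition beta_ribbon (d : ribbon_decomposition) : diagram :=
  ribbon (ssval (tagged d).1).
Definition gamma_ribbon (d : ribbon_decomposition) : diagram :=
  ribbon (ssval (tagged d).2).

End Decomposition.

(* Main.v *)
(** Cutting a standard tableau of shape [alpha] at the value [m] is a bijection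
    onto the pairs of standard tableaux of shapes [beta] and [gamma] that keeps
    every entry in its row; this gives the first isomorphism.

    For the second one, it suffices to decompose the module of one generalized
    ribbon [D] into those of the ribbons in its bracket.  Read tableaux from
    southwest to northeast as permutations.  For a ribbon [D'] in the bracket, send
    a tableau [t] of [D] to the sum of its rearrangements within the rows of [D], in
    the left regular module, and then antisymmetrize along the columns of [D'].
    Both steps commute with the action.  Every permutation that is standard for [D]
    is standard for exactly one [D'], and since [t] is lexicographically minimal
    among its row rearrangements, while a tableau of [D'] is maximal among its
    column rearrangements, the sum of these maps over all [D'] has a unitriangular
    matrix. *)

From HB Require Import structures.
Require Import Defs.
From mathcomp Require Import all_boot all_order all_algebra.
From mathcomp Require Import perm fingroup boolp zify.

Set Implicit Arguments.
Unset Strict Implicit.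
Unset Printing Implicit Defensive.

Import GRing.Theory.
Local Open Scope ring_scope.

(** * Isomorphisms and equivariance of maps *)

Lemma lmod_iso_of (R : pzRingType) (U V : lmodType R) (f : U -> V) :
  linear f -> bijective f -> lmod_iso U V.
Proof.
move=> fL fB; pose L := GRing.isLinear.Build R U V *:%R f fL.
by exists (HB.pack f L : {linear U -> V}).
Qed.

(** The elements of [A] whose action commutes with [f] are closed under sums and products. Scalars
    are written [a%:A] because [U] and [V] are modules over [A] only. *)
Lemma gen_subalg_equivariant (F : pzRingType) (A : algType F) (S : A -> Prop)
    (U V : lmodType A) (f : U -> V) :
    {morph f : u v / u + v} ->
    (forall a u, f (a%:A *: u) = a%:A *: f u) ->
    (forall x, S x -> forall u, f (x *: u) = x *: f u) ->
  forall x, gen_subalg S x -> forall u, f (x *: u) = x *: f u.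
Proof.
move=> fD fZ fS x; elim=> {x} [x Sx|a|x y _ fx _ fy|x y _ fx _ fy] u.
- exact: fS.
- exact: fZ.
- by rewrite !scalerDl fD fx fy.
- by rewrite -!scalerA fx fy.
Qed.

(** * Boxes of entries and the action on coordinates *)

Section BoxOf.
Variables (N : nat) (D : diagram).
Implicit Types (t x : tableau N D) (i : 'I_N.-1).

(** Whether exchanging two entries keeps a tableau standard depends on columns too, so [row_of] is
    not enough. The default is never reached, as every value occurs in a tableau. *)
Definition box_of t (k : 'I_N) : box :=
  if [pick p | t p == k] is Some p then box_at p else (0, 0)%N.

Lemma box_of_entry t p : box_of t (t p) = box_at p.
Proof.
rewrite /box_of; case: pickP => [q /eqP/entry_inj -> //|/(_ p)].
by rewrite eqxx.
Qed.

Lemma row_ofE t k : row_of t k = (box_of t k).1.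
Proof. by have [p <-] := entry_surj t k; rewrite row_of_entry box_of_entry. Qed.

Lemma tableau_eq t x : t =1 x -> t = x.
Proof. by move=> e; apply/val_inj/ffunP. Qed.

Lemma box_of_lt t k l : precedes (box_of t k) (box_of t l) -> (k < l)%N.
Proof.
have [p <-] := entry_surj t k; have [q <-] := entry_surj t l.
by rewrite !box_of_entry; apply: entry_lt.
Qed.

(** The two values are consecutive, so exchanging them can only reverse the inequality between their
    own boxes. Unlike [swapE], this also applies when [lo i] is in the higher row. *)
Lemma entry_swap i t : ~~ precedes (box_of t (lo i)) (box_of t (hi i)) ->
  forall p, swap i t p = tperm (lo i) (hi i) (t p).
Proof.
move=> np p; rewrite /swap insubdK ?ffunE // -topredE /=; apply/and3P; split.
- by apply/injectiveP=> q r; rewrite !ffunE => /perm_inj/entry_inj.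
- apply/forallP=> k; apply/existsP.
  have [q tq] := entry_surj t (tperm (lo i) (hi i) k).
  by exists q; rewrite ffunE tq tpermK.
- apply/forallP=> q; apply/forallP=> r; apply/implyP=> qr.
  rewrite !ffunE; have := entry_lt t qr.
  case: (tpermP _ _ (t q)) => [q1|q1|/eqP q1 /eqP q2];
    case: (tpermP _ _ (t r)) => [r1|r1|/eqP r1 /eqP r2];
    rewrite ?q1 ?r1 //=; try lia;
    try (move: q1 q2 || move: r1 r2); rewrite -?val_eqE /=; try lia.
  by move: np; rewrite -q1 -r1 !box_of_entry qr.
Qed.

Lemma box_of_swap i t k : ~~ precedes (box_of t (lo i)) (box_of t (hi i)) ->
  box_of (swap i t) k = box_of t (tperm (lo i) (hi i) k).
Proof.
move=> np; have [p tp] := entry_surj (swap i t) k.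
by rewrite -[in LHS]tp box_of_entry -tp entry_swap // tpermK box_of_entry.
Qed.

Lemma swapK i t : ~~ precedes (box_of t (lo i)) (box_of t (hi i)) ->
  swap i (swap i t) = t.
Proof.
move=> np; apply: tableau_eq => p; rewrite !entry_swap ?tpermK //.
(* The boxes are now interchanged: the forbidden precedence would give [hi i < lo i] in [t]. *)
rewrite !box_of_swap // tpermL tpermR; apply/negP=> /box_of_lt /=.
by rewrite ltnNge leqnSn.
Qed.

Variable F : fieldType.

(* When [lo i] is higher than [hi i], [swap i x] is standard unless
   the two boxes share a column. *)
Lemma pi_op_val i (v : {ffun tableau N D -> F^o}) x :
  pi_op F D i v x =
    if ((box_of x (lo i)).1 <= (box_of x (hi i)).1)%N then v x
    else if (box_of x (lo i)).2 == (box_of x (hi i)).2 then 0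
    else v (swap i x).
Proof.
have swN y : (row_of y (lo i) < row_of y (hi i))%N ->
    ~~ precedes (box_of y (lo i)) (box_of y (hi i)).
  move=> lt; apply/negP=> /[dup] /box_of_lt _; rewrite /precedes -!row_ofE; lia.
have swne y : (row_of y (lo i) < row_of y (hi i))%N ->
    (row_of x (lo i) <= row_of x (hi i))%N -> (x == swap i y) = false.
  by move=> lt le; apply/eqP=> E; move: le; rewrite E swap_lo // swap_hi // leqNgt lt.
(* At most one basis tableau contributes to the coefficient at [x]: [x] itself if [lo i] is not
   higher than [hi i], and otherwise [swap i x]. *)
rewrite lin_delta -!row_ofE.
have ty (y : tableau N D) := ltngtP (row_of y (lo i)) (row_of y (hi i)).
case: leqP => [le|gt].
  rewrite (bigD1 x) //= big1 ?addr0 => [|y yx].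
    case: (ltngtP (row_of x (lo i)) (row_of x (hi i))) le => // [lt|eq] _.
      by rewrite pi_lt // !ffunE eqxx swne ?addr0 ?mulr1 // ltnW.
    by rewrite pi_eq // ffunE eqxx mulr1.
  case: (ty y) => [lt|gt|eq].
  - by rewrite pi_lt // !ffunE swne // eq_sym (negPf yx) addr0 mulr0.
  - by rewrite pi_gt // ffunE mulr0.
  - by rewrite pi_eq // ffunE eq_sym (negPf yx) mulr0.
have px : precedes (box_of x (lo i)) (box_of x (hi i)) =
    ((box_of x (lo i)).2 == (box_of x (hi i)).2).
  by rewrite /precedes -!row_ofE gt andbT; case: eqP; lia.
have other y : x != swap i y \/ (row_of y (hi i) <= row_of y (lo i))%N ->
    v y * pi_op F D i (delta F y) x = 0.
  move=> H; have xy : (row_of y (lo i) <= row_of y (hi i))%N -> (x == y) = false.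
    by move=> le; apply/eqP=> E; move: gt; rewrite E ltnNge le.
  case: (ty y) H => [lt|gt'|eq] H.
  - rewrite pi_lt // !ffunE (xy (ltnW lt)) add0r.
    by case: H => [/negPf->|//]; rewrite mulr0.
  - by rewrite pi_gt // ffunE mulr0.
  - by rewrite pi_eq // ffunE xy ?eq // mulr0.
case: eqP => [eqc|/eqP nec].
  (* A [y] with [swap i y = x] would have [hi i] above [lo i] in one column. *)
  rewrite big1 // => y _; apply: other.
  case: (ltnP (row_of y (lo i)) (row_of y (hi i))) => [lt|]; [left|by right].
  apply/eqP=> E; move: px; rewrite eqc eqxx E !box_of_swap ?swN //.
  by rewrite tpermL tpermR => /box_of_lt /=; rewrite ltnNge leqnSn.
have np : ~~ precedes (box_of x (lo i)) (box_of x (hi i)) by rewrite px.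
have lt : (row_of (swap i x) (lo i) < row_of (swap i x) (hi i))%N.
  by rewrite !row_ofE !box_of_swap // tpermL tpermR -!row_ofE.
rewrite (bigD1 (swap i x)) //= big1 ?addr0 => [|y yx].
  rewrite pi_lt // swapK // !ffunE eqxx.
  case: eqP => [E|_]; last by rewrite add0r mulr1.
  by move: lt; rewrite -E ltnNge (ltnW gt).
apply: other.
case: (ltnP (row_of y (lo i)) (row_of y (hi i))) => [lt'|]; [left|by right].
by apply: contraNneq yx => ->; rewrite swapK // swN.
Qed.

End BoxOf.

(** * Words of tableaux of generalized ribbons *)

(** Indexed by all naturals, so that positions in ['I_N] need no cast to ['I_(size D)]. *)
Definition nth_box (D : diagram) (p : nat) : box := nth (0, 0)%N D p.
Arguments nth_box : simpl never.

(** Each kind of step weakly increases row and column and strictly increases their sum, and this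
    relation is transitive. *)
Lemma generalized_ribbon_mono D p q : generalized_ribbon D ->
    (p < q)%N -> (q < size D)%N ->
  [/\ ((nth_box D p).1 <= (nth_box D q).1)%N,
      ((nth_box D p).2 <= (nth_box D q).2)%N
    & ((nth_box D p).1 + (nth_box D p).2 < (nth_box D q).1 + (nth_box D q).2)%N].
Proof.
move=> gD pq qD.
pose r := [rel b b' : box |
  [&& (b.1 <= b'.1)%N, (b.2 <= b'.2)%N & (b.1 + b.2 < b'.1 + b'.2)%N]].
have rT : transitive r by move=> b a c /=; lia.
have /(sorted_ltn_nth rT (0, 0)%N) : sorted r D.
  apply: sub_sorted gD => -[a b] [c d].
  by rewrite /ribbon_step /right_of /above /northeast !xpair_eqE /=; lia.
move/(_ p q); rewrite !inE => /(_ (ltn_trans pq qD) qD pq).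
by case/and3P.
Qed.

(** Reading order runs forwards along rows and backwards along columns, so a box precedes a later
    one only through a common row and, by [precedes_col], an earlier one only through a common
    column. *)
Lemma precedes_row D p q : generalized_ribbon D -> (p < q)%N -> (q < size D)%N ->
  precedes (nth_box D p) (nth_box D q) = ((nth_box D p).1 == (nth_box D q).1).
Proof.
move=> gD pq qD; have [] := generalized_ribbon_mono gD pq qD.
by rewrite /precedes; lia.
Qed.

Lemma precedes_col D p q : generalized_ribbon D -> (p < q)%N -> (q < size D)%N ->
  precedes (nth_box D q) (nth_box D p) = ((nth_box D p).2 == (nth_box D q).2).
Proof.
move=> gD pq qD; have [] := generalized_ribbon_mono gD pq qD.
by rewrite /precedes; lia.
Qed.

Section Words.
Variables (N : nat) (D : diagram) (sD : size D = N).
Implicit Types (t x : tableau N D) (i : 'I_N.-1) (w : 'S_N).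

Lemma cast_entry_inj t : injective (fun p : 'I_N => t (cast_ord (esym sD) p)).
Proof. by move=> p q /entry_inj/cast_ord_inj. Qed.

(* The entries of [t] read from southwest to northeast. *)
Definition word t : 'S_N := perm (@cast_entry_inj t).

Lemma wordE t p : word t (cast_ord sD p) = t p.
Proof. by rewrite permE cast_ordK. Qed.

Lemma word_inj : injective word.
Proof. by move=> t x tx; apply: tableau_eq => p; rewrite -!wordE tx. Qed.

Lemma box_at_nth (p : 'I_(size D)) : box_at p = nth_box D p.
Proof. exact: tnth_nth. Qed.

Lemma box_of_word t k : box_of t k = nth_box D ((word t)^-1 k)%g.
Proof.
have [p <-] := entry_surj t k.
by rewrite box_of_entry -wordE permK box_at_nth.
Qed.

Lemma word_lt t (p q : 'I_N) :
  precedes (nth_box D p) (nth_box D q) -> (word t p < word t q)%N.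
Proof.
rewrite -(cast_ordKV sD p) -(cast_ordKV sD q) !wordE -!box_at_nth.
exact: entry_lt.
Qed.

Lemma word_onto w :
    (forall p q : 'I_N, precedes (nth_box D p) (nth_box D q) -> (w p < w q)%N) ->
  exists t, word t = w.
Proof.
move=> wlt.
have st : standard [ffun p : 'I_(size D) => w (cast_ord sD p)].
  apply/and3P; split.
  - by apply/injectiveP=> p q; rewrite !ffunE => /perm_inj/cast_ord_inj.
  - apply/forallP=> k; apply/existsP; exists (cast_ord (esym sD) (w^-1 k)%g).
    by rewrite ffunE cast_ordKV permKV.
  - apply/forallP=> p; apply/forallP=> q; apply/implyP.
    by rewrite !ffunE !box_at_nth => /(wlt (cast_ord sD p) (cast_ord sD q)).
exists (Tableau st); apply/permP=> p.
by rewrite -(cast_ordKV sD p) wordE /= ffunE.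
Qed.

(** Products of permutations apply the left factor first: a transposition on the right exchanges
    values, one on the left exchanges positions. *)
Lemma word_swap i t : ~~ precedes (box_of t (lo i)) (box_of t (hi i)) ->
  word (swap i t) = (word t * tperm (lo i) (hi i))%g.
Proof.
move=> np; apply/permP=> p.
by rewrite -(cast_ordKV sD p) permM !wordE entry_swap.
Qed.

End Words.

(** * The module map from a generalized ribbon to a ribbon *)

(** An ascent of the inverse of [w]; by contrast, [descents] compares the values at consecutive
    positions. *)
Definition ascent N (i : 'I_N.-1) (w : 'S_N) : bool :=
  ((w^-1)%g (lo i) < (w^-1)%g (hi i))%N.

Lemma ascent_tperm N (i : 'I_N.-1) (w : 'S_N) :
  ascent i (w * tperm (lo i) (hi i))%g = ~~ ascent i w.
Proof.
rewrite /ascent invMg tpermV !permM tpermL tpermR -leqNgt ltn_neqAle.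
rewrite (_ : (_ == _ :> nat) = false) //.
by apply/eqP=> /val_inj/perm_inj/(congr1 val) /=; lia.
Qed.

(* The left regular module, as an action on functions of a permutation. *)
Definition regular_op (F : Type) N (i : 'I_N.-1) (g : 'S_N -> F) (w : 'S_N) : F :=
  if ascent i w then g w else g (w * tperm (lo i) (hi i))%g.

Section RowSum.
Variables (F : fieldType) (N : nat) (D : diagram) (sD : size D = N).
Hypothesis gD : generalized_ribbon D.
Implicit Types (t : tableau N D) (v : {ffun tableau N D -> F^o}).
Implicit Types (i : 'I_N.-1) (w : 'S_N).

(** Such [w] are the words obtained from that of [t] by permuting entries inside the rows of [D]. *)
Definition row_equiv w t : bool :=
  [forall k, (nth_box D ((w^-1)%g k)).1 == row_of t k].

Lemma row_equivP w t :
  reflect (forall k, (nth_box D ((w^-1)%g k)).1 = row_of t k) (row_equiv w t).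
Proof. exact: eqfunP. Qed.

(** The coefficient at [w] once every tableau is replaced by the sum of its row rearrangements. *)
Definition row_sum v w : F := \sum_(t | row_equiv w t) v t.

Lemma ascent_row i w :
  if ascent i w
  then ((nth_box D ((w^-1)%g (lo i))).1 <= (nth_box D ((w^-1)%g (hi i))).1)%N
  else ((nth_box D ((w^-1)%g (hi i))).1 <= (nth_box D ((w^-1)%g (lo i))).1)%N.
Proof.
have lt p : ((w^-1)%g p < size D)%N by rewrite sD.
rewrite /ascent; case: ltnP => [lh|].
  by have [] := generalized_ribbon_mono gD lh (lt _).
rewrite leq_eqVlt => /orP[/eqP-> //|hl].
by have [] := generalized_ribbon_mono gD hl (lt _).
Qed.

Lemma row_equiv_tperm i w t t' :
    (forall k, row_of t' k = row_of t (tperm (lo i) (hi i) k)) ->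
  row_equiv (w * tperm (lo i) (hi i))%g t = row_equiv w t'.
Proof.
move=> tt'; apply/row_equivP/row_equivP=> H k.
  by rewrite tt' -H invMg tpermV permM tpermK.
by rewrite invMg tpermV permM H tt' tpermK.
Qed.

Lemma row_sum_basis t w : row_sum (delta F t) w = (row_equiv w t)%:R.
Proof.
rewrite /row_sum; case: (boolP (row_equiv w t)) => H.
  rewrite (bigD1 t) //= ffunE eqxx big1 ?addr0 // => s /andP[_ /negPf st].
  by rewrite ffunE st.
rewrite big1 // => s ws; rewrite ffunE.
by case: eqP => // E; rewrite -E ws in H.
Qed.

Lemma row_sum_lin v w : row_sum v w = \sum_t v t * (row_equiv w t)%:R.
Proof.
rewrite [LHS]big_mkcond; apply: eq_bigr => t _.
by case: ifP; rewrite ?mulr1 ?mulr0.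
Qed.

Lemma row_sumD u v w : row_sum (u + v) w = row_sum u w + row_sum v w.
Proof. by rewrite -big_split; apply: eq_bigr => t _; rewrite ffunE. Qed.

(** By linearity a single tableau [t] suffices. If [lo i] is lower than [hi i], all rearrangements
    of [t] have the ascent, and the transposition carries them to those of [swap i t]. If it is
    higher, none has the ascent and both sides vanish. In a common row, the transposition permutes
    the rearrangements. *)
Lemma row_sum_op i v w :
  row_sum (pi_op F D i v) w = regular_op i (row_sum v) w.
Proof.
have -> : row_sum (pi_op F D i v) w =
    \sum_t v t * row_sum (pi_op F D i (delta F t)) w.
  rewrite /row_sum.
  under [RHS]eq_bigr do rewrite mulr_sumr.
  by rewrite exchange_big; apply: eq_bigr => s _ /=; rewrite -lin_delta.
have -> : regular_op i (row_sum v) w =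
    \sum_t v t * regular_op i (row_sum (delta F t)) w.
  rewrite /regular_op; case: ifP => _; rewrite row_sum_lin;
  by apply: eq_bigr => s _; rewrite row_sum_basis.
apply: eq_bigr => t _; congr (_ * _).
rewrite /regular_op.
set w' := (w * _)%g.
have asc_lt u s : row_equiv u s -> (row_of s (lo i) < row_of s (hi i))%N -> ascent i u.
  move=> /row_equivP us lt; have := ascent_row i u; rewrite !us.
  by case: ifP => // _; rewrite leqNgt lt.
have asc_gt u s : row_equiv u s -> (row_of s (hi i) < row_of s (lo i))%N -> ~~ ascent i u.
  move=> /row_equivP us lt; have := ascent_row i u; rewrite !us.
  by case: ifP => // _; rewrite leqNgt lt.
case: (ltngtP (row_of t (lo i)) (row_of t (hi i))) => [lt|gt|eq].
- rewrite pi_lt // row_sumD !row_sum_basis.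
  have sw : row_equiv w' t = row_equiv w (swap i t).
    by apply: row_equiv_tperm => k; rewrite row_swap.
  have swgt : (row_of (swap i t) (hi i) < row_of (swap i t) (lo i))%N.
    by rewrite swap_lo ?swap_hi.
  case: ifPn => asc.
    suff -> : row_equiv w (swap i t) = false by rewrite addr0.
    by apply/negP=> /asc_gt/(_ swgt); rewrite asc.
  suff -> : row_equiv w t = false by rewrite add0r sw.
  by apply/negP=> /asc_lt/(_ lt); apply/negP.
- rewrite pi_gt // !row_sum_basis /row_sum big1 => [|s _]; last by rewrite ffunE.
  case: ifPn => asc.
    case: (boolP (row_equiv w t)) => // /asc_gt/(_ gt).
    by rewrite asc.
  case: (boolP (row_equiv w' t)) => // /asc_gt/(_ gt).
  by rewrite ascent_tperm asc.
- rewrite pi_eq // !row_sum_basis.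
  suff -> : row_equiv w' t = row_equiv w t by rewrite if_same.
  by apply: row_equiv_tperm => k; case: tpermP => [->|->|].
Qed.

End RowSum.

Section ColumnSum.
Variables (F : fieldType) (N : nat) (D : diagram) (sD : size D = N).
Hypothesis gD : generalized_ribbon D.
Implicit Types (x : tableau N D) (g : 'S_N -> F) (i : 'I_N.-1) (q w : 'S_N).

Definition col_stable q : bool :=
  [forall p, (nth_box D (q p)).2 == (nth_box D p).2].

Lemma col_stableP q :
  reflect (forall p : 'I_N, (nth_box D (q p)).2 = (nth_box D p).2) (col_stable q).
Proof. exact: eqfunP. Qed.

(* Multiplying a word on the left by [q] moves its entries between boxes. *)
Definition column_sum g x : F :=
  \sum_(q | col_stable q) (-1) ^+ q * g (q * word sD x)%g.

(** If [lo i] and [hi i] share a column of [x], then [lo i] is above and both sides vanish.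
    Otherwise no column permutation changes the order of their positions, so all terms of the sum
    fall under the same case of [regular_op]. *)
Lemma column_sum_op i g x :
  column_sum (regular_op i g) x = pi_op F D i [ffun x => column_sum g x] x.
Proof.
rewrite pi_op_val !ffunE.
have lt (p : 'I_N) : (p < size D)%N by rewrite sD.
set w := word sD x.
set pl := (w^-1)%g (lo i); set ph := (w^-1)%g (hi i).
have hl : ph != pl.
  by apply/eqP=> /perm_inj/(congr1 val) /=; lia.
have wl : w pl = lo i by rewrite permKV.
have wh : w ph = hi i by rewrite permKV.
rewrite !(box_of_word sD) -/w -/pl -/ph.
have [ceq|cne] := eqVneq (nth_box D pl).2 (nth_box D ph).2.
  have gt : ((nth_box D ph).1 < (nth_box D pl).1)%N.
    rewrite ltnNge; apply/negP=> le.
    case: (ltngtP pl ph) hl => [lh|lh|/val_inj->]; rewrite ?eqxx // => _.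
      have := @word_lt _ _ sD x ph pl; rewrite -/w wl wh /= precedes_col // ceq eqxx.
      by move/(_ isT); lia.
    by have [] := generalized_ribbon_mono gD lh (lt _); lia.
  rewrite leqNgt gt /= /column_sum (bigID (fun q => ascent i (q * w)%g)) /=.
  (* Exchanging the boxes of [lo i] and [hi i] cancels the terms in pairs. *)
  rewrite addrC (reindex_inj (mulIg (tperm pl ph))) /=.
  have wt q : (q * tperm pl ph * w = q * w * tperm (lo i) (hi i))%g.
    by apply/permP=> k; rewrite !permM inj_tperm ?wl ?wh //; apply: perm_inj.
  have -> : \sum_(q | col_stable (q * tperm pl ph) && ~~ ascent i (q * tperm pl ph * w)%g)
        (-1) ^+ (q * tperm pl ph)%g * regular_op i g (q * tperm pl ph * w)%g =
      \sum_(q | col_stable q && ascent i (q * w)%g)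
        - ((-1) ^+ q * regular_op i g (q * w)%g).
    apply: eq_big => q.
      rewrite wt ascent_tperm negbK; congr (_ && _).
      apply/col_stableP/col_stableP => H p; rewrite -[RHS]H permM.
        by case: tpermP => [->|->|].
      by case: tpermP => [->|->|].
    rewrite wt ascent_tperm negbK => /andP[_ asc].
    rewrite /regular_op ascent_tperm asc /= -mulgA tperm2 mulg1.
    by rewrite odd_permM odd_tperm eq_sym hl signr_addb expr1 mulrN1 mulNr.
  by rewrite sumrN addNr.
(* Columns weakly increase along positions, so moving boxes within two distinct columns preserves
   their order. *)
have ascE q : col_stable q -> ascent i (q * w)%g = (pl < ph)%N.
  move=> /col_stableP qc.
  have qV p : (nth_box D ((q^-1)%g p)).2 = (nth_box D p).2.
    by rewrite -(qc ((q^-1)%g p)) permKV.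
  have mono (a b a' b' : 'I_N) :
      (nth_box D a).2 = (nth_box D a').2 -> (nth_box D b).2 = (nth_box D b').2 ->
      ((nth_box D a').2 != (nth_box D b').2) -> (a < b)%N -> (a' < b')%N.
    move=> ea eb nab ab; have [_ + _] := generalized_ribbon_mono gD ab (lt _).
    rewrite ea eb => le; rewrite ltnNge; apply/negP; rewrite leq_eqVlt.
    case/orP=> [/eqP/val_inj E|ba]; first by rewrite E eqxx in nab.
    by have [_ + _] := generalized_ribbon_mono gD ba (lt _); lia.
  rewrite /ascent !invMg !permM -/pl -/ph.
  by apply/idP/idP; apply: mono; rewrite ?qV.
(* If [hi i] came first in a common row, that row would not increase. *)
have rows : ((nth_box D pl).1 <= (nth_box D ph).1)%N = (pl < ph)%N.
  case: (ltngtP pl ph) hl => [lh|lh|/val_inj->]; rewrite ?eqxx // => _.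
    by have [] := generalized_ribbon_mono gD lh (lt _).
  have [le1 le2 le3] := generalized_ribbon_mono gD lh (lt _).
  apply/negbTE; rewrite -ltnNge ltn_neqAle le1 andbT.
  apply/negP=> req.
  have := @word_lt _ _ sD x ph pl; rewrite -/w wl wh precedes_row // req /=.
  by move/(_ isT); lia.
rewrite rows; case: ifP => lh.
  by apply: eq_bigr => q /ascE; rewrite /regular_op lh => ->.
apply: eq_bigr => q /ascE.
rewrite /regular_op lh => ->; rewrite word_swap ?mulgA //.
rewrite !(box_of_word sD) -/w -/pl -/ph.
case: (ltngtP pl ph) hl lh => // [hl _ _|/val_inj->]; last by rewrite eqxx.
rewrite precedes_col //; apply/eqP => E; by rewrite E eqxx in cne.
Qed.

End ColumnSum.

(** * Unitriangular matrices and lexicographic ranks *)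

(** A vector [v] with [v *m A = 0] vanishes: at an index of maximal rank in its support, only the
    diagonal entry contributes. *)
Lemma unitriangular_inverse (F : fieldType) (X : finType) (M : X -> X -> F)
    (r : X -> nat) :
    (forall x, M x x = 1) ->
    (forall x y, x != y -> M x y != 0 -> (r y < r x)%N) ->
  exists K : X -> X -> F,
    (forall x z, \sum_y M x y * K y z = (x == z)%:R) /\
    (forall x z, \sum_y K x y * M y z = (x == z)%:R).
Proof.
move=> M1 Mlt; pose A := \matrix_(i < #|X|, j < #|X|) M (enum_val i) (enum_val j).
have Au : A \in unitmx.
  rewrite -row_free_unit; apply: inj_row_free => v vA.
  apply/eqP/contraT => /rV0Pn[i0 vi0].
  case: (@arg_maxnP _ i0 (fun i => v 0 i != 0) (fun i => r (enum_val i)) vi0).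
  move=> i vi imax; have /rowP/(_ i) := vA; rewrite !mxE (bigD1 i) //= mxE M1 mulr1.
  rewrite big1 ?addr0 => [/eqP|j ji]; first by rewrite (negPf vi).
  rewrite mxE; have [->|vj] := eqVneq (v 0 j) 0; first by rewrite mul0r.
  have [->|Mji] := eqVneq (M (enum_val j) (enum_val i)) 0; first by rewrite mulr0.
  have := Mlt _ _ _ Mji; rewrite (inj_eq enum_val_inj) => /(_ ji).
  by move: (imax j vj) => /= le; rewrite ltnNge le.
pose K x y := invmx A (enum_rank x) (enum_rank y).
have sumE (f : X -> F) : \sum_y f y = \sum_(i < #|X|) f (enum_val i).
  rewrite (reindex (@enum_val _ X)) //=.
  by exists enum_rank => ? _; [exact: enum_valK | exact: enum_rankK].
exists K; split=> x z; rewrite sumE.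
  have /matrixP/(_ (enum_rank x) (enum_rank z)) := mulmxV Au.
  rewrite !mxE (inj_eq enum_rank_inj) => <-; apply: eq_bigr => i _.
  by rewrite mxE /K enum_valK !enum_rankK.
have /matrixP/(_ (enum_rank x) (enum_rank z)) := mulVmx Au.
rewrite !mxE (inj_eq enum_rank_inj) => <-; apply: eq_bigr => i _.
by rewrite mxE /K enum_valK !enum_rankK.
Qed.

(** The number with digits [f 0], ..., [f n.-1] in base [b], most significant first. *)
Fixpoint base_value (b : nat) (f : nat -> nat) (n : nat) : nat :=
  if n is n'.+1 then (base_value b f n' * b + f n')%N else 0%N.

Lemma base_value_lt b f g p n : (p < n)%N -> (forall j, f j < b)%N ->
    (forall j, j < p -> f j = g j)%N -> (f p < g p)%N ->
  (base_value b f n < base_value b g n)%N.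
Proof.
elim: n => // n IHn; rewrite ltnS leq_eqVlt => /orP[/eqP->|pn] fb fg lt /=.
  have E m : (m <= n)%N -> base_value b f m = base_value b g m.
    by elim: m => //= m IHm mn; rewrite IHm ?fg // ltnW.
  by rewrite E // ltn_add2l.
(* A gap of at least 1 becomes a gap of at least [b], which the digit [f n] cannot make up. *)
have := IHn pn fb fg lt; have := fb n; nia.
Qed.

(* Comparing these values compares words lexicographically. *)
Definition lex_rank N (w : 'S_N) : nat :=
  base_value N.+1
    (fun j => if insub j is Some p then nat_of_ord (w p) else 0%N) N.

Lemma lex_rank_lt N (u w : 'S_N) :
    (forall p : 'I_N, (forall j : 'I_N, (j < p)%N -> u j = w j) -> u p != w p ->
       (u p < w p)%N) ->
  u != w -> (lex_rank u < lex_rank w)%N.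
Proof.
move=> first_diff uw.
have [p0 up0] : exists p, u p != w p.
  apply/existsP; rewrite -negb_forall; apply: contra uw => /forallP uw.
  by apply/eqP/permP=> p; apply/eqP.
case: (@arg_minnP _ p0 (fun p => u p != w p) (@nat_of_ord N) up0) => p up pmin.
have agree (j : 'I_N) : (j < p)%N -> u j = w j.
  by move=> jp; apply/eqP/contraT=> /pmin; rewrite leqNgt jp.
apply: (@base_value_lt _ _ _ p) => [|j|j jp|]; first exact: ltn_ord.
(* Letters are below [N] and the default digit is 0, so the base [N.+1] exceeds every digit, even
   for [N = 0]. *)
- by case: insubP => // q _ _; rewrite ltnS ltnW.
- by rewrite insubT ?(ltn_trans jp) // => H; rewrite agree.
- by rewrite valK; apply: first_diff.
Qed.

Section Triangular.
Variables (N : nat) (D : diagram) (sD : size D = N).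
Hypothesis gD : generalized_ribbon D.

(** At the first difference [p], the letter [w p] stands in [t] in the same row as [p], and not
    before [p], where the words agree. It is therefore further right in that row, and larger than
    the entry of [t] at [p]. *)
Lemma row_equiv_lex w (t : tableau N D) : row_equiv w t -> word sD t != w ->
  (lex_rank (word sD t) < lex_rank w)%N.
Proof.
move=> /row_equivP wt; apply: lex_rank_lt => p agree tp.
pose p' := ((word sD t)^-1)%g (w p).
have tp' : word sD t p' = w p by rewrite permKV.
have row : (nth_box D p).1 = (nth_box D p').1.
  by rewrite -[in LHS](permK w p) wt row_ofE (box_of_word sD).
rewrite -tp'; apply: word_lt; rewrite precedes_row ?row ?sD //.
case: (ltngtP p p') => // [lt|/val_inj E]; last by rewrite -tp' -E eqxx in tp.
by have /perm_inj E := etrans (esym (agree _ lt)) tp'; rewrite E ltnn in lt.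
Qed.

(** At the first position [p] moved by [q], the image [q p] is a later position of the same column,
    hence a higher box with a smaller entry. *)
Lemma col_stable_lex q (x : tableau N D) : col_stable D q ->
    (q * word sD x)%g != word sD x ->
  (lex_rank (q * word sD x)%g < lex_rank (word sD x))%N.
Proof.
move=> /col_stableP qc; apply: lex_rank_lt => p agree.
rewrite permM => xp; apply: word_lt.
rewrite precedes_col ?sD ?qc //.
case: (ltngtP p (q p)) => // [lt|/val_inj E]; last by rewrite -E eqxx in xp.
by have := agree _ lt; rewrite permM => /perm_inj/perm_inj E; rewrite E ltnn in lt.
Qed.

End Triangular.

Section RibbonMap.
Variables (F : fieldType) (N : nat) (D D' : diagram).
Hypotheses (sD : size D = N) (sD' : size D' = N).
Hypotheses (gD : generalized_ribbon D) (gD' : generalized_ribbon D').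
Implicit Types (t : tableau N D) (x : tableau N D').

Definition ribbon_coef x t : F := column_sum sD' (row_sum (delta F t)) x.

Lemma ribbon_coef_lin (v : {ffun tableau N D -> F^o}) x :
  \sum_t ribbon_coef x t * v t = column_sum sD' (row_sum v) x.
Proof.
rewrite /ribbon_coef /column_sum.
under eq_bigr do rewrite mulr_suml.
rewrite exchange_big; apply: eq_bigr => q _ /=.
rewrite (row_sum_lin v) mulr_sumr; apply: eq_bigr => t _.
by rewrite row_sum_basis -mulrA; congr (_ * _); apply: mulrC.
Qed.

Lemma ribbon_coef_op i (v : {ffun tableau N D -> F^o}) x :
  \sum_t ribbon_coef x t * pi_op F D i v t =
  pi_op F D' i [ffun x => \sum_t ribbon_coef x t * v t] x.
Proof.
rewrite ribbon_coef_lin.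
have -> : [ffun x => \sum_t ribbon_coef x t * v t] =
    [ffun x => column_sum sD' (row_sum v) x].
  by apply/ffunP=> y; rewrite !ffunE ribbon_coef_lin.
rewrite -column_sum_op //; apply: eq_bigr => q _.
by rewrite (row_sum_op sD).
Qed.

(** Some column permutation [q] contributes. Then the word of [t] is lexicographically at most [q]
    times that of [x], which is at most that of [x]. *)
Lemma ribbon_coef_lt x t : ribbon_coef x t != 0 -> word sD' x != word sD t ->
  (lex_rank (word sD t) < lex_rank (word sD' x))%N.
Proof.
move=> nz xt.
case: (boolP [exists q : 'S_N, col_stable D' q && row_equiv (q * word sD' x)%g t]).
  case/existsP=> q /andP[qc qt].
  have := row_equiv_lex (sD := sD) gD qt.
  have := col_stable_lex (sD := sD') gD' qc (x := x).
  have [->|_] := eqVneq (q * word sD' x)%g (word sD' x).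
    by move=> _; rewrite eq_sym; apply.
  move/(_ isT)=> lt; have [->//|_ /(_ isT)] := eqVneq (word sD t) (q * word sD' x)%g.
  by move=> lt'; apply: ltn_trans lt.
rewrite negb_exists => /forallP H; case/eqP: nz.
apply: big1 => q qc; rewrite row_sum_basis; have := H q; rewrite qc /= => /negPf->.
by rewrite mulr0.
Qed.

(** The identity contributes 1. Any other contributing [q] would give a word both above and below
    that of [t]. *)
Lemma ribbon_coef1 x t : word sD' x = word sD t -> ribbon_coef x t = 1.
Proof.
move=> xt; rewrite /ribbon_coef /column_sum (bigD1 1%g) /=; last first.
  by apply/col_stableP => p; rewrite perm1.
rewrite odd_perm1 mul1g mul1r row_sum_basis.
have -> : row_equiv (word sD' x) t.
  by apply/row_equivP=> k; rewrite xt row_ofE (box_of_word sD).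
rewrite big1 ?addr0 // => q /andP[qc q1]; rewrite row_sum_basis.
case: (boolP (row_equiv _ _)) => [qt|]; last by rewrite mulr0.
have qx : (q * word sD' x)%g != word sD' x.
  by apply: contra q1 => /eqP/(canRL (mulgK _)); rewrite mulgV => ->.
have := col_stable_lex gD' qc qx; have := row_equiv_lex (sD := sD) gD qt.
rewrite -xt eq_sym qx => /(_ isT) lt /(ltn_trans lt).
by rewrite ltnn.
Qed.

End RibbonMap.

(** * Brackets and descents *)

Definition adjacent (T S : Type) (f : T -> T -> S) (s : seq T) : seq S :=
  if s is x :: s' then pairmap f x s' else [::].

Lemma size_adjacent T S (f : T -> T -> S) s : size (adjacent f s) = (size s).-1.
Proof. by case: s => //= x s; rewrite size_pairmap. Qed.

Lemma nth_adjacent T S (f : T -> T -> S) x0 y0 s p : (p.+1 < size s)%N ->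
  nth y0 (adjacent f s) p = f (nth x0 s p) (nth x0 s p.+1).
Proof. by case: s => //= x s ps; rewrite (nth_pairmap x0). Qed.

(* [Some false] for a step to the right, [Some true] for a step upwards, [None]
   for the passage to the next connected component. *)
Definition step_kind (b b' : box) : option bool :=
  if b' == right_of b then Some false
  else if b' == above b then Some true else None.

Definition code : diagram -> seq (option bool) := adjacent step_kind.

(** Each passage between components is resolved freely: [true] for concatenation, [false] for near
    concatenation. *)
Definition refines : seq bool -> seq (option bool) -> bool :=
  all2 (fun d o => if o is Some d' then d == d' else true).

Lemma refinesP e c : size e = size c ->
  reflect (forall p d, nth None c p = Some d -> nth false e p = d) (refines e c).
Proof.
elim: e c => [|d e IHe] [|o c] //= => [_|[/IHe {}IHe]].
  by apply: ReflectT => p d; rewrite nth_nil.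
apply: (iffP andP) => [[od /IHe H] [|p] d' //= E|H].
- by move: od; rewrite E => /eqP.
- exact: H.
- split; last by apply/IHe => p; apply: (H p.+1).
  by case: o H => // d' /(_ 0%N d' erefl) /= ->.
Qed.

Lemma refines_size e c : refines e c -> size e = size c.
Proof. by rewrite /refines all2E => /andP[/eqP]. Qed.

Lemma refines_Some e e' : refines e [seq Some d | d <- e'] = (e == e').
Proof.
by elim: e e' => [|d e IHe] [|d' e'] //=; rewrite eqseq_cons IHe.
Qed.

Lemma step_kind_row b b' : ribbon_step b b' ->
  (b.1 == b'.1) = (step_kind b b' == Some false).
Proof.
case: b b' => r c [r' c'].
rewrite /ribbon_step /step_kind /right_of /above /northeast !xpair_eqE /=.
have [e1 e2 e3] : [/\ (Some false == Some false), (Some true == Some false) = false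
  & (None == Some false) = false] by [].
by case: ifP => [|_]; last case: ifP; rewrite ?e1 ?e2 ?e3; lia.
Qed.

Lemma step_kind_col b b' : ribbon_step b b' ->
  (b.2 == b'.2) = (step_kind b b' == Some true).
Proof.
case: b b' => r c [r' c'].
rewrite /ribbon_step /step_kind /right_of /above /northeast !xpair_eqE /=.
have [e1 e2 e3] : [/\ (Some true == Some true), (Some false == Some true) = false
  & (None == Some true) = false] by [].
by case: ifP => [|_]; last case: ifP; rewrite ?e1 ?e2 ?e3; lia.
Qed.

Section Descents.
Variable N : nat.

Definition values (w : 'S_N) : seq nat := [seq nat_of_ord (w p) | p <- enum 'I_N].

Definition descents (w : 'S_N) : seq bool :=
  adjacent (fun a b => (b < a)%N) (values w).

Lemma size_values w : size (values w) = N.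
Proof. by rewrite size_map size_enum_ord. Qed.

Lemma nth_values w (p : 'I_N) : nth 0%N (values w) p = w p.
Proof. by rewrite (nth_map p) ?size_enum_ord // nth_ord_enum. Qed.

(** A row or column of a generalized ribbon consists of consecutive boxes, so the conditions on
    neighbours, which [code] records, chain up to all the others. *)
Lemma standard_refines (D : diagram) (w : 'S_N) :
    generalized_ribbon D -> size D = N ->
  (forall p q : 'I_N, precedes (nth_box D p) (nth_box D q) -> (w p < w q)%N) <->
  refines (descents w) (code D).
Proof.
move=> gD sD.
have stepD p : (p.+1 < N)%N -> ribbon_step (nth_box D p) (nth_box D p.+1).
  by rewrite -sD => /(sortedP (0, 0)%N gD).
have kindD p : (p.+1 < N)%N ->
    nth None (code D) p = step_kind (nth_box D p) (nth_box D p.+1).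
  by rewrite -sD; apply: nth_adjacent.
have descD p : (p.+1 < N)%N ->
    nth false (descents w) p = (nth 0 (values w) p.+1 < nth 0 (values w) p)%N.
  by move=> pN; rewrite /descents (@nth_adjacent _ _ _ 0%N) ?size_values.
have val_eq p q (pN : (p < N)%N) (qN : (q < N)%N) :
    nth 0%N (values w) p = nth 0%N (values w) q -> p = q.
  have := nth_values w (Ordinal pN); have := nth_values w (Ordinal qN) => /= -> ->.
  by move=> /val_inj/perm_inj[].
have szE : size (descents w) = size (code D).
  by rewrite !size_adjacent size_values sD.
split=> [H|/(refinesP szE) H p q].
  apply/(refinesP szE) => p d.
  case: (ltnP p.+1 N) => pN; last first.
    by rewrite nth_default // size_adjacent sD; lia.
  rewrite kindD // descD // => Ed.
  have ltp : (p.+1 < size D)%N by rewrite sD.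
  have := nth_values w (Ordinal (ltnW pN)); have := nth_values w (Ordinal pN).
  move=> /= -> ->; case: d Ed => Ed.
    have pr : precedes (nth_box D p.+1) (nth_box D p).
      by rewrite precedes_col // step_kind_col ?stepD // Ed.
    exact: (H (Ordinal pN) (Ordinal (ltnW pN)) pr).
  have pr : precedes (nth_box D p) (nth_box D p.+1).
    by rewrite precedes_row // step_kind_row ?stepD // Ed.
  apply/negbTE; rewrite -leqNgt ltnW //.
  exact: (H (Ordinal (ltnW pN)) (Ordinal pN) pr).
have mono p' q' : (p' <= q')%N -> (q' < N)%N ->
    ((nth_box D p').1 <= (nth_box D q').1)%N /\
    ((nth_box D p').2 <= (nth_box D q').2)%N.
  rewrite leq_eqVlt => /orP[/eqP->//|lt] qN.
  by have [|] := generalized_ribbon_mono gD lt; rewrite ?sD.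
have row_chain p' k : (p' + k.+1 < N)%N ->
    (nth_box D p').1 = (nth_box D (p' + k.+1)).1 ->
    (nth 0 (values w) p' < nth 0 (values w) (p' + k.+1))%N.
  elim: k => [|k IHk]; rewrite addnS ?addn0 => kN req.
    have /eqP := req; rewrite step_kind_row ?stepD // -kindD // => /eqP/H.
    rewrite descD // => /negbT; rewrite -leqNgt leq_eqVlt => /orP[/eqP/val_eq|//].
    by move=> /(_ (ltnW kN) kN); lia.
  (* Rows are monotone along positions, so every box between two boxes of one row lies in that
     row. *)
  have [r1 _] := mono p' (p' + k.+1)%N (leq_addr _ _) (ltnW kN).
  have [r2 _] := mono (p' + k.+1)%N _ (leqnSn _) kN.
  have {}IHk := IHk (ltnW kN) _; apply: (ltn_trans (IHk _)); first lia.
  have /eqP : (nth_box D (p' + k.+1)).1 = (nth_box D (p' + k.+1).+1).1 by lia.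
  rewrite step_kind_row ?stepD // -kindD // => /eqP/H.
  rewrite descD // => /negbT; rewrite -leqNgt leq_eqVlt => /orP[/eqP/val_eq|//].
  by move=> /(_ (ltnW kN) kN); lia.
have col_chain p' k : (p' + k.+1 < N)%N ->
    (nth_box D p').2 = (nth_box D (p' + k.+1)).2 ->
    (nth 0 (values w) (p' + k.+1) < nth 0 (values w) p')%N.
  elim: k => [|k IHk]; rewrite addnS ?addn0 => kN req.
    have /eqP := req; rewrite step_kind_col ?stepD // -kindD // => /eqP/H.
    by rewrite descD.
  have [_ r1] := mono p' (p' + k.+1)%N (leq_addr _ _) (ltnW kN).
  have [_ r2] := mono (p' + k.+1)%N _ (leqnSn _) kN.
  have {}IHk := IHk (ltnW kN) _; apply: (ltn_trans _ (IHk _)); last lia.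
  have /eqP : (nth_box D (p' + k.+1)).2 = (nth_box D (p' + k.+1).+1).2 by lia.
  by rewrite step_kind_col ?stepD // -kindD // => /eqP/H; rewrite descD.
case: (ltngtP p q) => [pq|qp|/val_inj->].
- rewrite precedes_row ?sD // => /eqP req; have := row_chain p (q - p).-1.
  have -> : (p + (q - p).-1.+1 = q)%N by lia.
  by rewrite !nth_values => ->.
- rewrite precedes_col ?sD // => /eqP req; have := col_chain q (p - q).-1.
  have -> : (q + (p - q).-1.+1 = p)%N by lia.
  by rewrite !nth_values => ->.
- by rewrite /precedes !ltnn !andbF.
Qed.

End Descents.

Definition inc_head (a : seq nat) : seq nat := if a is x :: a' then x.+1 :: a' else [::].

(* The composition whose ribbon has the given sequence of steps. *)
Definition composition_of (e : seq bool) : seq nat :=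
  foldr (fun d a => if d then 1%N :: a else inc_head a) [:: 1%N] e.

Lemma composition_of_pos e :
  exists x a, composition_of e = x.+1 :: a.
Proof.
elim: e => [|[] e [x [a IHe]]] /=; first by exists 0%N, [::].
  by exists 0%N, (composition_of e).
by rewrite IHe; exists x.+1, a.
Qed.

Lemma ribbon_at_inc r c x a :
  ribbon_at r c (x.+2 :: a) = (r, c) :: ribbon_at r c.+1 (x.+1 :: a).
Proof.
have -> : ribbon_at r c (x.+2 :: a) =
    [seq (r, (c + j)%N) | j <- iota 0 x.+2] ++ ribbon_at r.+1 (c + x.+1) a by [].
rewrite -[iota 0 x.+2]/(0%N :: iota (1 + 0) x.+1) iotaDl map_cons -map_comp addn0.
rewrite -addSnnS cat_cons; congr (_ :: _); congr (_ ++ _).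
by apply: eq_map => j /=; rewrite addnS.
Qed.

(** The starting box is general because the rest of the ribbon starts one box above or to the right
    of it. *)
Lemma ribbon_at_composition r c e :
  exists L, [/\ ribbon_at r c (composition_of e) = (r, c) :: L,
    pairmap step_kind (r, c) L = [seq Some d | d <- e] & path ribbon_step (r, c) L].
Proof.
elim: e r c => [|[] e IHe] r c /=; first by exists [::]; rewrite addn0.
  have [L [rE E gL]] := IHe r.+1 c; exists ((r.+1, c) :: L).
  rewrite !addn0 rE /= E gL andbT; split=> //; last first.
    by rewrite /ribbon_step /above eqxx orbT.
  by rewrite /step_kind; case: ifP => [|_]; rewrite ?eqxx // xpair_eqE /=; lia.
have [x [a xa]] := composition_of_pos e; rewrite xa [inc_head _]/= ribbon_at_inc -xa.
have [L [-> E gL]] := IHe r c.+1; exists ((r, c.+1) :: L); split=> //=.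
  by rewrite E /step_kind eqxx.
by rewrite gL /ribbon_step eqxx.
Qed.

Lemma ribbon_composition e :
  [/\ code (ribbon (composition_of e)) = [seq Some d | d <- e],
      size (ribbon (composition_of e)) = (size e).+1
    & generalized_ribbon (ribbon (composition_of e))].
Proof.
have [L [rE cE gL]] := ribbon_at_composition 0 0 e.
rewrite /generalized_ribbon /code /ribbon rE; split=> //=.
by rewrite -(size_pairmap step_kind (0, 0)%N) cE size_map.
Qed.

(* One step of the fold that defines [bracket]. *)
Definition join_ribbons (B : seq (seq nat)) (c : seq nat) : seq (seq nat) :=
  [seq b ++ c | b <- B] ++ [seq near_cat b c | b <- B].

Lemma near_cat_neq0 b c : b != [::] -> near_cat b c != [::].
Proof. by case: b => [//|x [|y b]] _; case: c. Qed.

(** Joins act at the end of a composition, so they commute with changes at its beginning. For an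
    empty [b] the beginning would belong to [c]. *)
Lemma join_ribbons_map (f : seq nat -> seq nat) (B s : seq (seq nat)) :
    (forall b c, b != [::] -> f (b ++ c) = f b ++ c) ->
    (forall b c, b != [::] -> f (near_cat b c) = near_cat (f b) c) ->
    all (fun b => b != [::]) B ->
  foldl join_ribbons [seq f b | b <- B] s = [seq f b | b <- foldl join_ribbons B s].
Proof.
move=> fc fn; elim: s B => //= c s IHs B B0; rewrite -IHs.
  congr foldl; rewrite /join_ribbons map_cat -!map_comp.
  by congr (_ ++ _); apply/eq_in_map => b /(allP B0) b0 /=; rewrite ?fc ?fn.
rewrite /join_ribbons all_cat !all_map; apply/andP; split.
  by apply/allP=> b /(allP B0) /=; case: b.
by apply/allP=> b /(allP B0) /=; apply: near_cat_neq0.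
Qed.

(** Only membership is compared, because each join lists concatenations before near concatenations
    and thus interleaves the two lists. *)
Lemma mem_join_ribbons_cat (B B' s : seq (seq nat)) :
  foldl join_ribbons (B ++ B') s =i foldl join_ribbons B s ++ foldl join_ribbons B' s.
Proof.
have eqm r (C C' : seq (seq nat)) : C =i C' ->
    foldl join_ribbons C r =i foldl join_ribbons C' r.
  elim: r C C' => //= c r IHr C C' CC'; apply: IHr => b.
  by rewrite !mem_cat; congr (_ || _); apply/eq_mem_map.
elim: s B B' => //= c s IHs B B' b; rewrite -IHs; apply: eqm => {}b.
by rewrite /join_ribbons !map_cat !mem_cat; do !case: (_ \in _).
Qed.

(** Rules out the default branch of [components]. *)
Lemma components_shape b D : exists x a s, components (b :: D) = (x.+1 :: a) :: s.
Proof.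
elim: D b => [|b' D IHD] b; first by exists 0%N, [::], [::].
have [x [a [s /= ->]]] := IHD b'.
case: ifP => _; first by exists x.+1, a, s.
case: ifP => _; first by exists 0%N, (x.+1 :: a), s.
by exists 0%N, [::], ((x.+1 :: a) :: s).
Qed.

(** [bracket] grows at the northeast end, while the induction removes the first box. The effect of
    that box, a longer first row or a new row of length 1, is moved through the fold. If the box is
    a component by itself, both effects occur. *)
Lemma mem_bracket_components b0 D b :
  b \in bracket (components (b0 :: D)) <->
  exists2 e, refines e (code (b0 :: D)) & b = composition_of e.
Proof.
rewrite /code [adjacent _ _]/=.
elim: D b0 b => [|b1 D IHD] b0 b.
  rewrite /= inE; split=> [/eqP->|[[|d e] //= _ ->]]; last by rewrite eqxx.
  by exists [::].
have bracketE c s : bracket (c :: s) = foldl join_ribbons [:: c] s by [].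
have [x [a [s E]]] := components_shape b1 D.
have {}IHD := IHD b1; rewrite E in IHD.
have incE : foldl join_ribbons [:: x.+2 :: a] s =
    [seq inc_head c | c <- bracket ((x.+1 :: a) :: s)].
  rewrite bracketE -join_ribbons_map //= => [[]|[|y [|z b']] [|t c]] //.
have consE : foldl join_ribbons [:: 1%N :: x.+1 :: a] s =
    [seq 1%N :: c | c <- bracket ((x.+1 :: a) :: s)].
  by rewrite bracketE -join_ribbons_map //= => [] [|y b'] c.
have incP : (exists2 c, c \in bracket ((x.+1 :: a) :: s) & b = inc_head c) <->
    exists2 e, refines e (pairmap step_kind b1 D) & b = composition_of (false :: e).
  split=> [[c /IHD[e re ->] ->]|[e re ->]]; first by exists e.
  by exists (composition_of e) => //; apply/IHD; exists e.
have consP : (exists2 c, c \in bracket ((x.+1 :: a) :: s) & b = 1%N :: c) <->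
    exists2 e, refines e (pairmap step_kind b1 D) & b = composition_of (true :: e).
  split=> [[c /IHD[e re ->] ->]|[e re ->]]; first by exists e.
  by exists (composition_of e) => //; apply/IHD; exists e.
have -> : components [:: b0, b1 & D] =
    match step_kind b0 b1 with
    | Some false => (x.+2 :: a) :: s
    | Some true => (1%N :: x.+1 :: a) :: s
    | None => [:: 1%N] :: (x.+1 :: a) :: s
    end.
  transitivity (match components (b1 :: D) with
      | (x :: a) :: s =>
          if b1 == right_of b0 then (x.+1 :: a) :: s
          else if b1 == above b0 then (1%N :: x :: a) :: s
          else [:: 1%N] :: (x :: a) :: s
      | s => s end) => //.
  by rewrite E /step_kind; case: ifP => // _; case: ifP.
rewrite [pairmap _ _ _]/=; case: (step_kind b0 b1) => [[]|].
- rewrite bracketE consE; split=> [/mapP/consP[e re ->]|[[|d e] //= /andP[/eqP-> re] bE]].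
    by exists (true :: e) => //=; rewrite re.
  by apply/mapP/consP; exists e.
- rewrite bracketE incE; split=> [/mapP/incP[e re ->]|[[|d e] //= /andP[/eqP-> re] bE]].
    by exists (false :: e) => //=; rewrite re.
  by apply/mapP/incP; exists e.
- rewrite bracketE [foldl _ _ _]/= mem_join_ribbons_cat mem_cat consE.
  rewrite incE; split.
    case/orP=> [/mapP/consP|/mapP/incP] [e re ->].
      by exists (true :: e) => //=.
    by exists (false :: e) => //=.
  case=> [[|d e]] //= re bE; apply/orP; case: d bE => bE; [left|right].
    by apply/mapP/consP; exists e.
  by apply/mapP/incP; exists e.
Qed.

Lemma bracket_ribbon D b : b \in bracket (components D) ->
  exists e, [/\ refines e (code D), code (ribbon b) = [seq Some d | d <- e],
    size (ribbon b) = size D & generalized_ribbon (ribbon b)].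
Proof.
case: D => [|b0 D]; first by rewrite /= inE => /eqP->; exists [::].
case/mem_bracket_components=> e re ->; have [cE sE gE] := ribbon_composition e.
by exists e; rewrite sE (refines_size re) size_adjacent.
Qed.

Lemma bracket_exists D e : refines e (code D) ->
  exists2 b, b \in bracket (components D) & code (ribbon b) = [seq Some d | d <- e].
Proof.
case: D => [|b0 D] re.
  by exists [::]; rewrite ?inE //=; case: e re.
exists (composition_of e); last by have [] := ribbon_composition e.
by apply/mem_bracket_components; exists e.
Qed.

Lemma bracket_code_inj D b b' :
    b \in bracket (components D) -> b' \in bracket (components D) ->
  code (ribbon b) = code (ribbon b') -> b = b'.
Proof.
case: D => [|b0 D]; first by rewrite /= !inE => /eqP-> /eqP->.
case/mem_bracket_components=> e _ -> /mem_bracket_components[e' _ ->].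
have [-> _ _] := ribbon_composition e; have [-> _ _] := ribbon_composition e'.
by move=> /inj_map-> // ? ? [].
Qed.

(** * Splitting a generalized ribbon into the ribbons of its bracket *)

Lemma word_refines N D (sD : size D = N) (t : tableau N D) :
  generalized_ribbon D -> refines (descents (word sD t)) (code D).
Proof. by move=> gD; apply/standard_refines => // p q; apply: word_lt. Qed.

(** [M] has a block of rows for each ribbon of the bracket. Equality of words matches its rows with
    the tableaux of [D], which makes it square and unitriangular; [K] is its inverse. *)
Lemma ribbon_split (F : fieldType) N D (sD : size D = N) :
    generalized_ribbon D ->
  exists (M : forall b : seq_sub (bracket (components D)),
            tableau N (ribbon (ssval b)) -> tableau N D -> F)
         (K : tableau N D ->
            {b : seq_sub (bracket (components D)) & tableau N (ribbon (ssval b))} -> F),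
  [/\ forall b i v x, \sum_t M b x t * pi_op F D i v t =
        pi_op F (ribbon (ssval b)) i [ffun x => \sum_t M b x t * v t] x,
      forall y y', \sum_t M (tag y) (tagged y) t * K t y' = (y == y')%:R
    & forall t t', \sum_y K t y * M (tag y) (tagged y) t' = (t == t')%:R].
Proof.
move=> gD; set I := seq_sub (bracket (components D)).
pose Y := {b : I & tableau N (ribbon (ssval b))}.
have sb (b : I) : size (ribbon (ssval b)) = N.
  by have [e [_ _ -> _]] := bracket_ribbon (ssvalP b).
have gb (b : I) : generalized_ribbon (ribbon (ssval b)).
  by have [e []] := bracket_ribbon (ssvalP b).
pose wd (y : Y) := word (sb (tag y)) (tagged y).
(* The descents of a word determine the ribbon for which it is standard. *)
have wd_inj : injective wd.
  have codeE (y : Y) :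
      code (ribbon (ssval (tag y))) = [seq Some d | d <- descents (wd y)].
    have := word_refines (sb (tag y)) (tagged y) (gb _).
    have [e [_ -> _ _]] := bracket_ribbon (ssvalP (tag y)).
    by rewrite refines_Some => /eqP->.
  move=> y y' yy'.
  have : code (ribbon (ssval (tag y))) = code (ribbon (ssval (tag y'))).
    by rewrite !codeE yy'.
  move=> /bracket_code_inj => /(_ _ (ssvalP _) (ssvalP _))/val_inj.
  case: y y' yy' => b x [b' x'] /= yy' E; rewrite /wd; move: x' yy'.
  by rewrite -E => x' h; have -> : x = x' by apply: word_inj h.
have psi (y : Y) : {t : tableau N D | word sD t == wd y}.
  apply: sigW; have [|t tE] := @word_onto _ _ sD (wd y).
    apply/(standard_refines _ gD sD).
    have := word_refines (sb (tag y)) (tagged y) (gb _); rewrite -/(wd y).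
    have [e [re -> _ _]] := bracket_ribbon (ssvalP (tag y)).
    by rewrite refines_Some => /eqP->.
  by exists t; rewrite tE.
have phi (t : tableau N D) : {y : Y | wd y == word sD t}.
  apply: sigW; have [b bD cb] := bracket_exists (word_refines sD t gD).
  pose b' : I := SeqSub bD.
  have [|x xE] := @word_onto _ _ (sb b') (word sD t).
    apply/(standard_refines _ (gb b') (sb b')).
    by rewrite [ssval b']/= cb refines_Some.
  by exists (existT _ b' x); apply/eqP.
have phiK : cancel (fun t => sval (phi t)) (fun y => sval (psi y)).
  move=> t; apply: (word_inj (sD := sD)).
  by rewrite (eqP (svalP (psi _))) (eqP (svalP (phi _))).
have psiK : cancel (fun y => sval (psi y)) (fun t => sval (phi t)).
  move=> y; apply: wd_inj.
  by rewrite (eqP (svalP (phi _))) (eqP (svalP (psi _))).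
pose M (b : I) (x : tableau N (ribbon (ssval b))) (t : tableau N D) : F :=
  ribbon_coef F (sb b) x t.
(* [M] with its rows relabelled by the tableaux of [D] having the same word. *)
pose M' (s t : tableau N D) : F := M _ (tagged (sval (phi s))) t.
have wE s : word (sb _) (tagged (sval (phi s))) = word sD s.
  exact: (eqP (svalP (phi s))).
have [||K [MK KM]] := @unitriangular_inverse F _ M' (fun t => lex_rank (word sD t)).
- by move=> s; apply: ribbon_coef1.
- move=> s t st nz; rewrite -(wE s); apply: ribbon_coef_lt nz _ => //.
  by rewrite wE (inj_eq (@word_inj _ _ sD)).
exists M, (fun t y => K t (sval (psi y))); split.
- by move=> b i v x; apply: ribbon_coef_op.
- move=> y y'; rewrite -(inj_eq (can_inj psiK)) -MK.
  by apply: eq_bigr => t _; rewrite /M' psiK.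
- move=> t t'; rewrite -KM (reindex (fun t => sval (phi t))) /=.
    by apply: eq_bigr => s _; rewrite phiK.
  by exists (fun y => sval (psi y)) => ? _; [apply: phiK | apply: psiK].
Qed.

(** * Shapes of parts and equivariance over the subalgebra *)

(** Consecutive boxes of one symbol are either neighbours in [alpha] or strictly northeast of each
    other: in a common row or column, the boxes between them would have the same symbol by
    monotonicity. *)
Lemma part_ribbon m n alpha (d : decomposition m n alpha) c :
  generalized_ribbon alpha -> generalized_ribbon (part d c).
Proof.
move=> ga; have /and3P[mono _ _] : is_decomposition m n d by case: d.
have {}mono (p q : 'I_(size alpha)) :
    precedes (nth_box alpha p) (nth_box alpha q) -> d p -> d q.
  move: mono => /forallP/(_ p)/forallP/(_ q)/implyP.
  by rewrite !box_at_nth => H /H/implyP.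
have key (a b : 'I_(size alpha)) : d a = c -> d b = c ->
    (forall p : 'I_(size alpha), (a < p)%N -> (p < b)%N -> d p != c) ->
    (a < b)%N -> ribbon_step (box_at a) (box_at b).
  move=> da db gap ab.
  rewrite !box_at_nth.
  have [rab cab _] := generalized_ribbon_mono ga ab (ltn_ord b).
  case: (ltnP (nth_box alpha a).1 (nth_box alpha b).1) => rlt; last first.
    have [ba|ne] := eqVneq (nat_of_ord b) a.+1.
      by rewrite ba; apply: (sortedP (0, 0)%N ga); rewrite -ba.
    have a1b : (a.+1 < b)%N by rewrite ltn_neqAle eq_sym ne.
    have a1s := ltn_trans a1b (ltn_ord b).
    have [r1 _ _] := generalized_ribbon_mono ga (ltnSn a) a1s.
    have [r2 _ _] := generalized_ribbon_mono ga a1b (ltn_ord b).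
    (* The box after [a] lies between [a] and [b] in their row, so its symbol is [c], against
       [gap]. *)
    have /negP[] := gap (Ordinal a1s) (ltnSn a) a1b.
    have := mono a (Ordinal a1s); have := mono (Ordinal a1s) b.
    rewrite precedes_row // precedes_row // da db.
    have -> : (nth_box alpha (Ordinal a1s)).1 == (nth_box alpha b).1 by rewrite /=; lia.
    have -> : (nth_box alpha a).1 == (nth_box alpha (Ordinal a1s)).1 by rewrite /=; lia.
    by move=> /(_ isT) H1 /(_ isT) H2; apply/eqP; apply/idP/idP.
  case: (ltnP (nth_box alpha a).2 (nth_box alpha b).2) => clt.
    by rewrite /ribbon_step /northeast rlt clt !orbT.
  have [ba|ne] := eqVneq (nat_of_ord b) a.+1.
    by rewrite ba; apply: (sortedP (0, 0)%N ga); rewrite -ba.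
  have a1b : (a.+1 < b)%N by rewrite ltn_neqAle eq_sym ne.
  have a1s := ltn_trans a1b (ltn_ord b).
  have [_ r1 _] := generalized_ribbon_mono ga (ltnSn a) a1s.
  have [_ r2 _] := generalized_ribbon_mono ga a1b (ltn_ord b).
  have /negP[] := gap (Ordinal a1s) (ltnSn a) a1b.
  have := mono (Ordinal a1s) a; have := mono b (Ordinal a1s).
  rewrite precedes_col // precedes_col // da db.
  have -> : (nth_box alpha (Ordinal a1s)).2 == (nth_box alpha b).2 by rewrite /=; lia.
  have -> : (nth_box alpha a).2 == (nth_box alpha (Ordinal a1s)).2 by rewrite /=; lia.
  by move=> /(_ isT) H1 /(_ isT) H2; apply/eqP; apply/idP/idP.
rewrite /generalized_ribbon /part.
set idx := filter _ _; apply/(sortedP (0, 0)%N) => i; rewrite size_map => ilt.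
have p0 : 'I_(size alpha) by case: idx ilt => // p.
rewrite !(nth_map p0) //; last exact: ltnW.
pose r := relpre (@nat_of_ord (size alpha)) ltn.
have rT : transitive r by move=> x y z; apply: ltn_trans.
have sidx : sorted r idx.
  by apply: sorted_filter => //; rewrite -sorted_map val_enum_ord iota_ltn_sorted.
have idx_lt j k : (k < size idx)%N -> (j < k)%N -> (nth p0 idx j < nth p0 idx k)%N.
  move=> ks jk; apply: (sorted_ltn_nth rT p0 sidx) => //.
  by rewrite inE; apply: ltn_trans ks.
have mem_idx p : (p \in idx) = (d p == c) by rewrite mem_filter mem_enum andbT.
have da : d (nth p0 idx i) = c.
  by apply/eqP; rewrite -mem_idx mem_nth // ltnW.
have db : d (nth p0 idx i.+1) = c by apply/eqP; rewrite -mem_idx mem_nth.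
have gap (p : 'I_(size alpha)) :
    (nth p0 idx i < p)%N -> (p < nth p0 idx i.+1)%N -> d p != c.
  move=> ap pb; apply/negP; rewrite -mem_idx => pin.
  have pE := nth_index p0 pin; have := pin; rewrite -index_mem => ks.
  move: ap pb; rewrite -{1 2}pE.
  case: (ltngtP (index p idx) i) => [lt|gt|->]; last by rewrite ltnn.
    by move=> ap _; have := ltn_trans ap (idx_lt _ _ (ltnW ilt) lt); rewrite ltnn.
  move: gt; rewrite leq_eqVlt => /orP[/eqP->|gt]; first by move=> _; rewrite ltnn.
  by move=> _ pb; have := ltn_trans pb (idx_lt _ _ ks gt); rewrite ltnn.
have ab := idx_lt _ _ ilt (ltnSn i).
exact: key gap ab.
Qed.

Lemma parabolic_equivariant (F : fieldType) m n (V W : lmodType F)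
    (opV : 'I_(m + n).-1 -> {linear V -> V}) (opW : 'I_(m + n).-1 -> {linear W -> W})
    (rV : hecke_rel opV) (rW : hecke_rel opW) (g : V -> W) :
    linear g ->
    (forall (i : 'I_(m + n).-1) u, i.+1 != m -> g (opV i u) = opW i (g u)) ->
  forall (h : hecke_par F m n) (u : hmod rV),
    g (par_incl F m n h *: u) = par_incl F m n h *: (g u : hmod rW).
Proof.
move=> gL gS h u.
have gD (x y : V) : g (x + y) = g x + g y by have := gL 1 x y; rewrite !scale1r.
have g0 : g 0 = 0 by apply: (addrI (g 0)); rewrite -gD !addr0.
have gZ a (x : V) : g (a *: x) = a *: g x by have := gL a x 0; rewrite g0 !addr0.
have /asboolP hP := valP h.
refine (@gen_subalg_equivariant _ _ _ (hmod rV) (hmod rW) g gD _ _ _ hP u).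
- by move=> a v; rewrite !scal_hmod; apply: gZ.
- by move=> _ [i im ->] v; rewrite !hgen_hmod; apply: gS.
Qed.

(** * Restriction to the parabolic subalgebra *)

Section Part.
Variables (alpha : diagram) (f : {ffun 'I_(size alpha) -> bool}) (c : bool).

Definition part_box (q : 'I_(size (part f c))) : 'I_(size alpha) :=
  tnth (in_tuple [seq p <- enum 'I_(size alpha) | f p == c])
    (cast_ord (size_map _ _) q).

Lemma box_at_part q : box_at (part_box q) = box_at q.
Proof.
rewrite [RHS](tnth_nth (0, 0)%N) /part_box (tnth_nth (part_box q)) /=.
by rewrite (nth_map (part_box q)) // -(size_map (@box_at alpha)).
Qed.

Lemma part_box_color q : f (part_box q) = c.
Proof.
have := mem_tnth (cast_ord (size_map _ _) q)
  (in_tuple [seq p <- enum 'I_(size alpha) | f p == c]).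
by rewrite mem_filter => /andP[/eqP].
Qed.

Lemma part_box_inj : injective part_box.
Proof.
move=> q r /tuple_uniqP-/(_ (filter_uniq _ (enum_uniq _))).
exact: cast_ord_inj.
Qed.

Lemma part_box_onto p : f p = c -> exists q, part_box q = p.
Proof.
move=> fp; have : p \in in_tuple [seq p <- enum 'I_(size alpha) | f p == c].
  by rewrite mem_filter fp eqxx mem_enum.
case/tnthP=> q ->; exists (cast_ord (esym (size_map _ _)) q).
by rewrite /part_box cast_ordKV.
Qed.

Lemma size_part : size (part f c) = #|[pred p | f p == c]|.
Proof.
rewrite size_map -(card_uniqP (filter_uniq _ (enum_uniq _))).
by apply: eq_card => p; rewrite mem_filter mem_enum andbT.
Qed.

End Part.

Section Glue.
Variables (m n : nat) (alpha : diagram) (size_alpha : size alpha = (m + n)%N).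
Variable d : decomposition m n alpha.
Implicit Types (x : tableau m (beta_part d)) (y : tableau n (gamma_part d)).

(** The last branch only fills the type: every box belongs to one of the two parts. *)
Definition glue_fun x y (p : 'I_(size alpha)) : 'I_(m + n) :=
  if [pick q | @part_box alpha d false q == p] is Some q then lshift n (x q)
  else if [pick q | @part_box alpha d true q == p] is Some q then rshift m (y q)
  else cast_ord size_alpha p.

Lemma glue_funL x y q : glue_fun x y (@part_box alpha d false q) = lshift n (x q).
Proof.
rewrite /glue_fun; case: pickP => [r /eqP/part_box_inj -> //|/(_ q)].
by rewrite eqxx.
Qed.

Lemma glue_funR x y q : glue_fun x y (@part_box alpha d true q) = rshift m (y q).
Proof.
rewrite /glue_fun; case: pickP => [r /eqP/(congr1 d)|_].
  by rewrite !part_box_color.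
case: pickP => [r /eqP/part_box_inj -> //|/(_ q)].
by rewrite eqxx.
Qed.

Lemma part_boxP (P : 'I_(size alpha) -> Prop) :
    (forall q, P (@part_box alpha d false q)) ->
    (forall q, P (@part_box alpha d true q)) ->
  forall p, P p.
Proof.
move=> PL PR p; case dp: (d p).
  by have [q <-] := part_box_onto dp.
by have [q <-] := part_box_onto dp.
Qed.

(** Inside a part the inequalities come from [x] or [y]. Entries of [beta] are smaller than those of
    [gamma], and a [gamma] box never precedes a [beta] box. *)
Lemma glue_standard x y : standard [ffun p => glue_fun x y p].
Proof.
have /and3P[mono _ _] : is_decomposition m n d by case: (d).
apply/and3P; split.
- apply/injectiveP=> p r; rewrite !ffunE.
  elim/part_boxP: p => p; elim/part_boxP: r => r;
    rewrite ?glue_funL ?glue_funR.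
  + by move/lshift_inj/entry_inj->.
  + by move/eqP; rewrite eq_lrshift.
  + by move/eqP; rewrite eq_rlshift.
  + by move/rshift_inj/entry_inj->.
- apply/forallP=> k; apply/existsP; rewrite -(splitK k).
  case: (split k) => j /=.
    by have [q <-] := entry_surj x j; exists (part_box q); rewrite ffunE glue_funL.
  by have [q <-] := entry_surj y j; exists (part_box q); rewrite ffunE glue_funR.
- apply/forallP=> p; apply/forallP=> r; apply/implyP=> pr; rewrite !ffunE.
  have := mono => /forallP/(_ p)/forallP/(_ r)/implyP/(_ pr)/implyP; move: pr.
  elim/part_boxP: p => p; elim/part_boxP: r => r;
    rewrite ?glue_funL ?glue_funR !box_at_part !part_box_color => pr /=.
  + by move=> _; apply: entry_lt.
  + by move=> _; apply: ltn_addr.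
  + by move/(_ isT).
  + by move=> _; rewrite ltn_add2l; apply: entry_lt.
Qed.

Definition glue x y : tableau (m + n) alpha := Tableau (glue_standard x y).

Lemma glueL x y q : glue x y (@part_box alpha d false q) = lshift n (x q).
Proof. by rewrite /= ffunE glue_funL. Qed.

Lemma glueR x y q : glue x y (@part_box alpha d true q) = rshift m (y q).
Proof. by rewrite /= ffunE glue_funR. Qed.

Lemma box_of_glueL x y k : box_of (glue x y) (lshift n k) = box_of x k.
Proof.
have [q <-] := entry_surj x k.
by rewrite -(glueL x y) !box_of_entry box_at_part.
Qed.

Lemma box_of_glueR x y k : box_of (glue x y) (rshift m k) = box_of y k.
Proof.
have [q <-] := entry_surj y k.
by rewrite -(glueR x y) !box_of_entry box_at_part.
Qed.

Variable F : fieldType.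
Implicit Types v : {ffun tableau (m + n) alpha -> F^o}.

(** By [pi_op_val] the action depends only on the boxes of two values, both in [beta] and unchanged
    by gluing; exchanging them affects [x] alone. *)
Lemma pi_glueL v x y (i : 'I_(m + n).-1) (j : 'I_m.-1) : i = j :> nat ->
  pi_op F alpha i v (glue x y) =
  pi_op F (beta_part d) j [ffun x => v (glue x y)] x.
Proof.
move=> ij; rewrite !pi_op_val !ffunE.
have -> : lo i = lshift n (lo j) by apply: val_inj.
have -> : hi i = lshift n (hi j) by apply: val_inj; rewrite /= ij.
rewrite !box_of_glueL.
case: leqP => // gt; case: eqP => // nc; congr (v _).
have np : ~~ precedes (box_of x (lo j)) (box_of x (hi j)).
  by rewrite /precedes; move/eqP: nc; lia.
have lE : lo i = lshift n (lo j) by apply: val_inj.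
have hE : hi i = lshift n (hi j) by apply: val_inj; rewrite /= ij.
apply: tableau_eq => p; rewrite entry_swap; last by rewrite lE hE !box_of_glueL.
rewrite lE hE; elim/part_boxP: p => q; rewrite ?glueL ?glueR.
  by rewrite entry_swap // inj_tperm //; apply: lshift_inj.
by rewrite tpermD // eq_lrshift.
Qed.

Lemma pi_glueR v x y (i : 'I_(m + n).-1) (j : 'I_n.-1) : i = (m + j)%N :> nat ->
  pi_op F alpha i v (glue x y) =
  pi_op F (gamma_part d) j [ffun y => v (glue x y)] y.
Proof.
move=> ij; rewrite !pi_op_val !ffunE.
have lE : lo i = rshift m (lo j) by apply: val_inj.
have hE : hi i = rshift m (hi j) by apply: val_inj; rewrite /= ij addnS.
rewrite lE hE !box_of_glueR.
case: leqP => // gt; case: eqP => // nc; congr (v _).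
have np : ~~ precedes (box_of y (lo j)) (box_of y (hi j)).
  by rewrite /precedes; move/eqP: nc; lia.
apply: tableau_eq => p; rewrite entry_swap; last by rewrite lE hE !box_of_glueR.
rewrite lE hE; elim/part_boxP: p => q; rewrite ?glueL ?glueR.
  by rewrite tpermD // eq_rlshift.
by rewrite entry_swap // inj_tperm //; apply: rshift_inj.
Qed.

End Glue.

Section GlueBijection.
Variables (m n : nat) (alpha : diagram) (size_alpha : size alpha = (m + n)%N).

Definition tableau_pairs : finType :=
  {d : decomposition m n alpha &
    (tableau m (beta_part d) * tableau n (gamma_part d))%type}.

Definition glue_pair (z : tableau_pairs) : tableau (m + n) alpha :=
  glue size_alpha (tagged z).1 (tagged z).2.

Lemma glue_pair_inj : injective glue_pair.
Proof.
case=> d [x y] [d' [x' y']] E.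
(* Entries are numbered from 0, so the [gamma] boxes are those with entry at least [m], and the
   tableau determines the filling. *)
have dE (d1 : decomposition m n alpha) x1 y1 p :
    d1 p = (m <= glue size_alpha (d := d1) x1 y1 p)%N.
  elim/(part_boxP (d := d1)): p => q; rewrite part_box_color ?glueL ?glueR /=.
    by rewrite leqNgt ltn_ord.
  by rewrite leq_addr.
have dd' : d = d'.
  have {}E : glue size_alpha x y = glue size_alpha x' y' := E.
  by apply/val_inj/ffunP=> p; rewrite [LHS](dE _ x y) [RHS](dE _ x' y') E.
case: _ / dd' x' y' E => x' y' E.
have {}E : glue size_alpha x y = glue size_alpha x' y' := E.
have -> : x = x'.
  apply: tableau_eq => q; apply: (@lshift_inj m n).
  by rewrite -(glueL size_alpha x y) -(glueL size_alpha x' y') E.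
have -> // : y = y'.
apply: tableau_eq => q; apply: (@rshift_inj m n).
by rewrite -(glueR size_alpha x y) -(glueR size_alpha x' y') E.
Qed.

Lemma glue_pair_onto t : exists z, glue_pair z = t.
Proof.
pose f := [ffun p => (m <= t p)%N].
pose pos k := cast_ord (esym size_alpha) ((word size_alpha t)^-1 k)%g.
have posK k : t (pos k) = k by rewrite -(wordE size_alpha) cast_ordKV permKV.
have tK p : pos (t p) = p by apply: (entry_inj (t := t)); rewrite posK.
have pos_inj : injective pos by apply: can_inj posK.
have df : is_decomposition m n f.
  apply/and3P; split.
  - apply/forallP=> p; apply/forallP=> q; apply/implyP=> /(entry_lt t) pq.
    by apply/implyP; rewrite !ffunE => /leq_trans; apply; apply: ltnW.
  - rewrite size_part -[X in _ == X](card_ord m).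
    (* The boxes of [beta] are counted by their entries, through the inverse [pos] of [t]. *)
    have /card_codom <- : injective (fun j => pos (lshift n j)).
      by move=> i j /pos_inj/lshift_inj.
    apply/eqP/eq_card => p; rewrite inE ffunE -[p]tK posK.
    apply/idP/codomP => [|[j /pos_inj->]].
      by rewrite eqbF_neg -ltnNge => H; exists (Ordinal H); congr pos; apply: val_inj.
    by rewrite eqbF_neg -ltnNge /=.
  - rewrite size_part -[X in _ == X](card_ord n).
    have /card_codom <- : injective (fun j => pos (rshift m j)).
      by move=> i j /pos_inj/rshift_inj.
    apply/eqP/eq_card => p; rewrite inE ffunE -[p]tK posK.
    apply/idP/codomP => [|[j /pos_inj->]]; last by rewrite /= leq_addr.
    rewrite eqb_id => H; have H' : (t p - m < n)%N by have := ltn_ord (t p); lia.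
    by exists (Ordinal H'); congr pos; apply: val_inj; rewrite /= subnKC.
pose d := Decomposition df.
have ltx (q : 'I_(size (beta_part d))) : (t (@part_box alpha d false q) < m)%N.
  by have /negbT := part_box_color q; rewrite ffunE -ltnNge.
have gey (q : 'I_(size (gamma_part d))) : (m <= t (@part_box alpha d true q))%N.
  by have := part_box_color q; rewrite ffunE.
have lty (q : 'I_(size (gamma_part d))) : (t (@part_box alpha d true q) - m < n)%N.
  by have := gey q; have := ltn_ord (t (@part_box alpha d true q)); lia.
have sx : standard [ffun q => Ordinal (ltx q)].
  apply/and3P; split.
  - apply/injectiveP=> q r; rewrite !ffunE => -[/val_inj/entry_inj].
    exact: part_box_inj.
  - apply/forallP=> k; apply/existsP.
    have [|q qE] := @part_box_onto alpha d false (pos (lshift n k)).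
      by rewrite ffunE posK /= leqNgt ltn_ord.
    by exists q; rewrite ffunE; apply/eqP/val_inj; rewrite /= qE posK.
  - apply/forallP=> p; apply/forallP=> q; apply/implyP; rewrite !ffunE /=.
    by rewrite -!box_at_part; apply: entry_lt.
have sy : standard [ffun q => Ordinal (lty q)].
  apply/and3P; split.
  - apply/injectiveP=> q r; rewrite !ffunE => -[E].
    apply: part_box_inj; apply/(entry_inj (t := t))/val_inj.
    by rewrite /= -(subnKC (gey q)) E subnKC.
  - apply/forallP=> k; apply/existsP.
    have [|q qE] := @part_box_onto alpha d true (pos (rshift m k)).
      by rewrite ffunE posK /= leq_addr.
    by exists q; rewrite ffunE; apply/eqP/val_inj; rewrite /= qE posK /= addKn.
  - apply/forallP=> p; apply/forallP=> q; apply/implyP; rewrite !ffunE /=.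
    rewrite -!box_at_part => /(entry_lt t) pq.
    by rewrite ltn_sub2r // (leq_ltn_trans (gey p)).
exists (existT _ d (Tableau sx, Tableau sy)); apply: tableau_eq => p.
rewrite /glue_pair; elim/(part_boxP (d := d)): p => q; rewrite ?glueL ?glueR;
  apply: val_inj; rewrite /= ffunE //=.
by rewrite subnKC.
Qed.

End GlueBijection.

Lemma restriction_iso (F : fieldType) m n alpha :
    size alpha = (m + n)%N ->
  lmod_iso (restriction (par_incl F m n) (Pmod F (m + n) alpha))
    (dsum (fun d : decomposition m n alpha =>
       Ptensor F m n (beta_part d) (gamma_part d))).
Proof.
move=> sa.
pose cut (d : decomposition m n alpha) (v : {ffun tableau (m + n) alpha -> F^o}) :
    {ffun tableau m (beta_part d) * tableau n (gamma_part d) -> F^o} :=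
  [ffun p => v (glue sa p.1 p.2)].
have cut_linear d : linear (@cut d) by move=> a u v; apply/ffunP=> p; rewrite !ffunE.
pose f (v : restriction (par_incl F m n) (Pmod F (m + n) alpha)) :
    dsum (fun d : decomposition m n alpha =>
       Ptensor F m n (beta_part d) (gamma_part d)) := [ffun d => cut d v].
have unglue t : {z | glue_pair sa z == t}.
  by apply: sigW; have [z <-] := glue_pair_onto sa t; exists z.
pose g (w : dsum (fun d : decomposition m n alpha =>
       Ptensor F m n (beta_part d) (gamma_part d))) :
    restriction (par_incl F m n) (Pmod F (m + n) alpha) :=
  ([ffun t => (w (tag (sval (unglue t))) : {ffun _ -> F^o}) (tagged (sval (unglue t)))]
     : {ffun tableau (m + n) alpha -> F^o}).
apply: (lmod_iso_of (f := f)); last first.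
  exists g => [v|w].
    apply/ffunP=> t; rewrite ffunE /f ffunE /cut ffunE.
    by rewrite -[in RHS](eqP (svalP (unglue t))).
  apply/ffunP=> d; rewrite ffunE; apply/ffunP=> p; rewrite ffunE /g ffunE.
  have := eqP (svalP (unglue (glue sa p.1 p.2))).
  rewrite -[RHS]/(glue_pair sa (existT _ d p)) => /glue_pair_inj ->.
  by [].
move=> h u v; apply/ffunP=> d; rewrite !ffunE.
have cutD x y : cut d (x + y) = cut d x + cut d y.
  by have := cut_linear d 1 x y; rewrite !scale1r.
rewrite -[LHS]/(cut d ((par_incl F m n h *: (u : Pmod F (m + n) alpha)) + v)).
rewrite cutD; congr (_ + _).
apply: (@parabolic_equivariant F m n _ _ _ _ (pi_rel F (m + n) alpha)
  (tens_rel (pi_rel F m (beta_part d)) (pi_rel F n (gamma_part d)))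
  (@cut d) (@cut_linear d) _ h u) => i {}u im.
apply/ffunP=> -[x y]; rewrite ffunE /=.
(* The third case is [pi_m], which is not a generator of the subalgebra. *)
case: tens_opP => [j ij|j ij|/eqP]; last by rewrite (negPf im).
  rewrite (pi_glueL _ _ _ _ ij) [RHS]ffunE; congr (pi_op _ _ _ _ _).
  by apply/ffunP=> z; rewrite !ffunE.
rewrite (pi_glueR _ _ _ _ ij) [RHS]ffunE; congr (pi_op _ _ _ _ _).
by apply/ffunP=> z; rewrite !ffunE.
Qed.

(** * Tensor products and the final isomorphism *)

(** The mixed-product rule for Kronecker products, applied to the vector [u]. *)
Lemma tensor_sum (R : comPzRingType) (I J I' J' : finType) (k : I -> R) (l : J -> R)
    (f : I -> I' -> R) (g : J -> J' -> R) (u : I' -> J' -> R) :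
  \sum_i \sum_j k i * l j * (\sum_i' \sum_j' f i i' * g j j' * u i' j') =
  \sum_i' \sum_j' (\sum_i k i * f i i') * (\sum_j l j * g j j') * u i' j'.
Proof.
rewrite pair_bigA [RHS]pair_bigA /=.
under eq_bigr do rewrite pair_bigA mulr_sumr /=.
rewrite exchange_big; apply: eq_bigr => -[i' j'] _ /=.
rewrite big_distrlr mulr_suml.
under [RHS]eq_bigr do rewrite mulr_suml.
rewrite [RHS]pair_bigA; apply: eq_bigr => -[i j] _ /=.
by rewrite !mulrA; congr (_ * _); rewrite -!mulrA; congr (_ * _); rewrite mulrCA.
Qed.

Lemma sum_kronecker (R : pzRingType) (I J : finType) (u : I -> J -> R) i0 j0 :
  \sum_i \sum_j (i0 == i)%:R * (j0 == j)%:R * u i j = u i0 j0.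
Proof.
rewrite (bigD1 i0) //= [X in _ + X]big1 ?addr0 => [|i /negPf ne]; last first.
  by apply: big1 => j _; rewrite eq_sym ne !mul0r.
rewrite (bigD1 j0) //= [X in _ + X]big1 ?addr0 => [|j /negPf ne]; last first.
  by rewrite [j0 == j]eq_sym ne mulr0 mul0r.
by rewrite !eqxx !mul1r.
Qed.

Section TensorOperators.
Variables (F : fieldType) (X Y : finType) (m n : nat).
Variable f : 'I_m.-1 -> {linear {ffun X -> F^o} -> {ffun X -> F^o}}.
Variable g : 'I_n.-1 -> {linear {ffun Y -> F^o} -> {ffun Y -> F^o}}.
Implicit Types i : 'I_(m + n).-1.

Lemma tens_opL i (j : 'I_m.-1) : i = j :> nat -> tens_op f g i = tensl Y (f j).
Proof.
have := ltn_ord j; case: tens_opP => [j' ->|j' ->|im] jm ij; try lia.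
by rewrite (ord_inj ij).
Qed.

Lemma tens_opR i (j : 'I_n.-1) : i = (m + j)%N :> nat ->
  tens_op f g i = tensr X (g j).
Proof.
case: tens_opP => [j' ->|j' ->|] ij; try (have := ltn_ord j'; lia); try lia.
by rewrite (ord_inj (addnI ij)).
Qed.

Lemma tens_op0 i : i.+1 = m -> tens_op f g i = tens0 F X Y.
Proof.
by case: tens_opP => // j ->; have := ltn_ord j; lia.
Qed.

End TensorOperators.

Section TensorSplit.
Variables (F : fieldType) (m n : nat) (beta gamma : diagram).
Hypotheses (s_beta : size beta = m) (s_gamma : size gamma = n).
Hypotheses (g_beta : generalized_ribbon beta) (g_gamma : generalized_ribbon gamma).
Local Notation refinement D := (seq_sub (bracket (components D))).
Local Notation tensors b c := {ffun tableau m b * tableau n c -> F^o}.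
Local Notation op b c := (tens_op (pi_op F b) (pi_op F c)).

(** Kronecker products of the matrices from [ribbon_split] for the two factors. The inverse [g]
    takes a whole family, since only the maps [f bc] together are invertible. *)
Lemma tensor_split :
  exists (f : forall bc : refinement beta * refinement gamma,
            tensors beta gamma -> tensors (ribbon (ssval bc.1)) (ribbon (ssval bc.2)))
         (g : (forall bc : refinement beta * refinement gamma,
                tensors (ribbon (ssval bc.1)) (ribbon (ssval bc.2))) ->
            tensors beta gamma),
  [/\ forall bc, linear (f bc),
      forall bc i u, f bc (op beta gamma i u) =
        op (ribbon (ssval bc.1)) (ribbon (ssval bc.2)) i (f bc u),
      forall u, g (fun bc => f bc u) = u
    & forall w bc, f bc (g w) = w bc].
Proof.
have [M [K [M_op MK KM]]] := ribbon_split F s_beta g_beta.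
have [M' [K' [M'_op MK' KM']]] := ribbon_split F s_gamma g_gamma.
pose f (bc : refinement beta * refinement gamma) (u : tensors beta gamma) :
    tensors (ribbon (ssval bc.1)) (ribbon (ssval bc.2)) :=
  [ffun p => \sum_t \sum_s M bc.1 p.1 t * M' bc.2 p.2 s * u (t, s)].
pose g (w : forall bc : refinement beta * refinement gamma,
    tensors (ribbon (ssval bc.1)) (ribbon (ssval bc.2))) : tensors beta gamma :=
  [ffun p => \sum_y \sum_z K p.1 y * K' p.2 z * w (tag y, tag z) (tagged y, tagged z)].
have f_linear bc : linear (f bc).
  move=> a u v; apply/ffunP=> p; rewrite !ffunE scaler_sumr -big_split.
  apply: eq_bigr => t _; rewrite scaler_sumr -big_split; apply: eq_bigr => s _.
  by rewrite !ffunE mulrDr; congr (_ + _); apply: mulrCA.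
exists f, g; split=> //.
- move=> bc i u; case: tens_opP => [j ij|j ij|im]; last 1 first.
  + rewrite tens_op0 //; apply/ffunP=> p; rewrite ffunE [RHS]ffunE.
    by apply: big1 => t _; apply: big1 => s _; rewrite ffunE mulr0.
  + rewrite (tens_opL _ _ ij); apply/ffunP=> -[x z]; rewrite ffunE exchange_big /=.
    (* With the second tableau fixed, the operator acts on a vector of the first factor, where
       [M_op] applies. *)
    pose slice s : {ffun tableau m beta -> F^o} := [ffun t => u (t, s)].
    pose image s : {ffun tableau m (ribbon (ssval bc.1)) -> F^o} :=
      [ffun x => \sum_t M bc.1 x t * slice s t].
    transitivity (\sum_s M' bc.2 z s * pi_op F (ribbon (ssval bc.1)) j (image s) x).
      apply: eq_bigr => s _; rewrite -M_op mulr_sumr; apply: eq_bigr => t _.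
      by rewrite [tensl _ _ _ _]ffunE mulrCA mulrA.
    rewrite [RHS]ffunE.
    have -> : [ffun x0 => f bc u (x0, (x, z).2)] =
        \sum_s M' bc.2 z s *: image s.
      apply/ffunP=> x'; rewrite sum_ffunE !ffunE exchange_big /=.
      apply: eq_bigr => s _; rewrite !ffunE [RHS]mulr_sumr; apply: eq_bigr => t _.
      by rewrite ffunE mulrCA mulrA.
    rewrite linear_sum sum_ffunE; apply: eq_bigr => s _.
    by rewrite linearZ [RHS]ffunE.
  + rewrite (tens_opR _ _ ij); apply/ffunP=> -[x z]; rewrite ffunE /=.
    pose slice t : {ffun tableau n gamma -> F^o} := [ffun s => u (t, s)].
    pose image t : {ffun tableau n (ribbon (ssval bc.2)) -> F^o} :=
      [ffun z => \sum_s M' bc.2 z s * slice t s].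
    transitivity (\sum_t M bc.1 x t * pi_op F (ribbon (ssval bc.2)) j (image t) z).
      apply: eq_bigr => t _; rewrite -M'_op mulr_sumr; apply: eq_bigr => s _.
      by rewrite [tensr _ _ _ _]ffunE mulrA.
    rewrite [RHS]ffunE.
    have -> : [ffun z0 => f bc u ((x, z).1, z0)] =
        \sum_t M bc.1 x t *: image t.
      apply/ffunP=> z'; rewrite sum_ffunE !ffunE /=.
      apply: eq_bigr => t _; rewrite !ffunE [RHS]mulr_sumr; apply: eq_bigr => s _.
      by rewrite ffunE mulrA.
    rewrite linear_sum sum_ffunE; apply: eq_bigr => t _.
    by rewrite linearZ [RHS]ffunE.
- move=> u; apply/ffunP=> -[t s]; rewrite ffunE /=.
  under eq_bigr => y _ do under eq_bigr => z _ do rewrite ffunE /=.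
  (* The double sum becomes a product of two matrix products, each an identity matrix. *)
  rewrite (tensor_sum _ _ (fun y => M (tag y) (tagged y))
    (fun z => M' (tag z) (tagged z)) (fun t s => u (t, s))).
  under eq_bigr => t' _ do under eq_bigr => s' _ do rewrite KM KM'.
  exact: (sum_kronecker (fun t s => u (t, s))).
- move=> w [b c]; apply/ffunP=> -[x z]; rewrite ffunE /=.
  under eq_bigr => t _ do under eq_bigr => s _ do rewrite ffunE /=.
  pose y0 : {b : refinement beta & tableau m (ribbon (ssval b))} := existT _ b x.
  pose z0 : {c : refinement gamma & tableau n (ribbon (ssval c))} := existT _ c z.
  rewrite (tensor_sum (M (tag y0) (tagged y0)) (M' (tag z0) (tagged z0)) K K'
    (fun y z => w (tag y, tag z) (tagged y, tagged z))).
  under eq_bigr => y' _ do under eq_bigr => z' _ do rewrite MK MK'.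
  exact: (sum_kronecker (fun y z => w (tag y, tag z) (tagged y, tagged z)) y0 z0).
Qed.

End TensorSplit.

(** Each decomposition is treated separately by [tensor_split], and the nested families are
    reindexed by pairs of a decomposition and its two ribbons. *)
Lemma ribbon_iso (F : fieldType) m n alpha : generalized_ribbon alpha ->
  lmod_iso
    (dsum (fun d : decomposition m n alpha =>
       Ptensor F m n (beta_part d) (gamma_part d)))
    (dsum (fun d : ribbon_decomposition m n alpha =>
       Ptensor F m n (beta_ribbon d) (gamma_ribbon d))).
Proof.
move=> ga.
have sizes (d : decomposition m n alpha) :
    size (beta_part d) = m /\ size (gamma_part d) = n.
  by have /and3P[_ /eqP ? /eqP ?] : is_decomposition m n d by case: (d).
have split_of (d : decomposition m n alpha) :=
  tensor_split F (sizes d).1 (sizes d).2 (part_ribbon d false ga) (part_ribbon d true ga).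
pose f d := sval (cid (split_of d)).
pose g d := sval (cid (svalP (cid (split_of d)))).
have fgP d := svalP (cid (svalP (cid (split_of d)))).
pose U := dsum (fun d : decomposition m n alpha =>
       Ptensor F m n (beta_part d) (gamma_part d)).
pose W := dsum (fun d : ribbon_decomposition m n alpha =>
       Ptensor F m n (beta_ribbon d) (gamma_ribbon d)).
pose fd (u : U) : W := [ffun d => f (tag d) (tagged d) (u (tag d))].
pose gd (w : W) : U := [ffun d => g d (fun bc => w (existT _ d bc))].
apply: (lmod_iso_of (f := fd)); last first.
  exists gd => [u|w].
    apply/ffunP=> d; rewrite ffunE; have [_ _ fgK _] := fgP d.
    rewrite -[RHS]fgK; congr (g d _); apply: functional_extensionality_dep => bc.
    by rewrite ffunE.
  apply/ffunP=> -[d bc]; rewrite ffunE /=; have [_ _ _ gfK] := fgP d.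
  by rewrite ffunE; apply: gfK.
move=> h u v; apply/ffunP=> -[d bc]; rewrite !ffunE /=.
have [f_lin f_op _ _] := fgP d.
have fD x y : f d bc (x + y) = f d bc x + f d bc y.
  by have := f_lin bc 1 x y; rewrite !scale1r.
rewrite [LHS]fD; congr (_ + _).
apply: (@parabolic_equivariant F m n _ _ _ _
  (tens_rel (pi_rel F m (beta_part d)) (pi_rel F n (gamma_part d)))
  (tens_rel (pi_rel F m (ribbon (ssval bc.1))) (pi_rel F n (ribbon (ssval bc.2))))
  (f d bc) (f_lin bc) _ h (u d)) => i x _.
exact: f_op.
Qed.

Theorem proposition4p5 (F : fieldType) (m n : nat) (alpha : diagram)
    (alpha_ribbon : generalized_ribbon alpha)
    (size_alpha : size alpha = (m + n)%N) :
  lmod_iso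
    (restriction (par_incl F m n) (Pmod F (m + n) alpha))
    (dsum (fun d : decomposition m n alpha =>
       Ptensor F m n (beta_part d) (gamma_part d)))
  /\
  lmod_iso
    (dsum (fun d : decomposition m n alpha =>
       Ptensor F m n (beta_part d) (gamma_part d)))
    (dsum (fun d : ribbon_decomposition m n alpha =>
       Ptensor F m n (beta_ribbon d) (gamma_ribbon d))).
Proof. by split; [apply: restriction_iso | apply: ribbon_iso]. Qed.
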